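(* Let $Y=(S^2\times S^3)\vee\Sigma\mathbb{C}P^2$, with multiplicative generators $\bar a_i\in H^i(S^i;\mathbb{Z}_2)$ ($i=2,3$), $\bar b\in H^3(\Sigma\mathbb{C}P^2;\mathbb{Z}_2)$ and $Sq^2\bar b\in H^5(\Sigma\mathbb{C}P^2;\mathbb{Z}_2)$. Let $f:Y\to K(\mathbb{Z}_2,5)$ be a map such that $f^*(\iota_5)=\bar a_2\bar a_3+Sq^2\bar b$, and let $p:X\to Y$ be the pullback along $f$ of the path fibration $\mathcal{L}K(\mathbb{Z}_2,5)\to K(\mathbb{Z}_2,5)$, so that $p$ has fiber $K(\mathbb{Z}_2,4)$. Put $a_i=p^*(\bar a_i)$, $b=p^*(\bar b)$ and $A=H^*(X;\mathbb{Z}_2)=\{1,a_2,a_3,b,a_2a_3=Sq^2b,\ldots\}$. Let $(BA,d,\Delta,\mu)$ be the DG Hopf algebra model for cochains on $\Omega X$ described in the context, let $H=H^*(BA)\approx H^*(\Omega X;\mathbb{Z}_2)$, with product $\mu_H$ induced by $\mu$ and coproduct $\Delta_H$ induced by $\Delta$, and let $\alpha_i=\mathrm{cls}[a_i]$ and $\beta=\mathrm{cls}[b]$ in $H$. Choose a cocycle-selecting map $g:H\to BA$ such that $g(\mathrm{cls}[x_1|\cdots|x_n])=[x_1|\cdots|x_n]$. Transfer the structure of $BA$ along $g$ to an $A_\infty$-bialgebra structure $\{\omega_H^{n,m}\}$ on $H$ together with a morphism $G=\{g_m^n\mid g_1^1=g\}:H\Rightarrow BA$ of $A_\infty$-bialgebras,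 where, among the possible choices in the transfer, the cochain homotopies $g_2^1$ and $g_1^2$ are chosen so that $$g_2^1(\beta\otimes\beta)=[a_2|a_3]\qquad\text{and}\qquad g_1^2(\beta)=0 .$$ Then $$\omega_H^{2,2}(\beta\otimes\beta)=\alpha_2\otimes\alpha_3 .$$ Thus the topology of the total space $X$ in the fibration $p:X\to(S^2\times S^3)\vee\Sigma\mathbb{C}P^2$ induces a nontrivial 2-in/2-out operation $\omega_H^{2,2}:H\otimes H\to H\otimes H$ on $H=H^*(\Omega X;\mathbb{Z}_2)$.
   Context: Everything is over $\mathbb{Z}_2$. $\Omega X$ is the space of base-pointed Moore loops on $X$, and $\mathrm{cls}$ denotes cohomology class. Bar construction. For a 1-connected DGA $(A,d_A)$ over $\mathbb{Z}_2$ with augmentation ideal $\overline A$, $BA$ is the cofree DG coalgebra $T^c(\downarrow\overline A)$, where $\downarrow$ is desuspension. Write $[x_1|\cdots|x_n]$ for $\downarrow x_1\otimes\cdots\otimes\downarrow x_n$, and $[\ ]$ for the generator of $T^0$. Then $$d[x_1|\cdots|x_n]=\sum_{i=1}^n[x_1|\cdots|d_Ax_i|\cdots|x_n]+\sum_{i=1}^{n-1}[x_1|\cdots|x_ix_{i+1}|\cdots|x_n],$$ $$\Delta[x_1|\cdots|x_n]=[\ ]\otimes[x_1|\cdots|x_n]+[x_1|\cdots|x_n]\otimes[\ ]+\sum_{i=1}^{n-1}[x_1|\cdots|x_i]\otimes[x_{i+1}|\cdots|x_n].$$ Here $A=H^*(X;\mathbb{Z}_2)$ has $d_A=0$. As coalgebras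 $H^*(BA)\approx H^*(\Omega X;\mathbb{Z}_2)$, and $(BA,d,\Delta)$ is a DG coalgebra model for cochains on $\Omega X$. Multiplication on $BA$ (Baues). The twisting in $X$ induces Steenrod's $\smile_1:A\otimes A\to A$, which acts non-trivially via $b\smile_1b=a_2a_3$, and the induced map $\phi:BA\otimes BA\to A$ acts non-trivially via $$\phi([x]\otimes[\ ])=\phi([\ ]\otimes[x])=x\quad\text{and}\quad\phi([b]\otimes[b])=b\smile_1b=a_2a_3.$$ Let $\sigma_{p,q}:(V^{\otimes p})^{\otimes q}\to(V^{\otimes q})^{\otimes p}$ be the canonical permutation of tensor factors. Give $BA\otimes BA$ the coproduct $\psi=\sigma_{2,2}(\Delta\otimes\Delta)$, with reduced coproduct $\bar\psi$; put $\bar\psi^{(0)}=\mathbf 1$ and $\bar\psi^{(k)}=(\bar\psi\otimes\mathbf 1^{\otimes k-1})\cdots(\bar\psi\otimes\mathbf 1)\bar\psi$ for $k>0$, and define $$\mu=\sum_{k\ge0}(\underbrace{\downarrow\phi\otimes\cdots\otimes\downarrow\phi}_{k+1\text{ factors}})\,\bar\psi^{(k)}:BA\otimes BA\to BA .$$ For example $\mu([b]\otimes[b])=[a_2a_3]$. Then $(BA,d,\Delta,\mu)$ is a DG Hopf algebra model for cochains on $\Omega X$. $A_\infty$-bialgebras and transfer. The free matrad $\mathcal H_\infty$ is represented by the cellular chains of the biassociahedra $KK_{n,m}$, whose top-dimensional cells correspond to generators $\theta_m^n$; the free relative matrad $\mathcal{JJ}_\infty$ is represented by the cellular chains of the bimultiplihedra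 $JJ_{n,m}$, whose top-dimensional cells correspond to generators $\mathfrak f_m^n$. An $A_\infty$-bialgebra is a DG module $V$ with multilinear operations $\omega_V^{n,m}\in Hom^{m+n-3}(V^{\otimes m},V^{\otimes n})$, $mn\ne1$, and a map of matrads $\mathcal H_\infty\to\mathcal End_{TV}$ sending $\theta_m^n\mapsto\omega_V^{n,m}$. A morphism $G:V\Rightarrow W$ of $A_\infty$-bialgebras is a family $g_m^n\in Hom^{m+n-2}(V^{\otimes m},W^{\otimes n})$ with a map of relative matrads $\mathcal{JJ}_\infty\to Hom(TV,TW)$ sending $\mathfrak f_m^n\mapsto g_m^n$. A DG Hopf algebra is an $A_\infty$-bialgebra whose only non-zero operations are its product and coproduct. The Transfer Theorem says that, for a chain map and homology isomorphism $g:V\to W$ into an $A_\infty$-bialgebra $W$ such that $u\mapsto g^{\otimes n}u$ (for $u\in Hom(V^{\otimes m},V^{\otimes n})$) is a homology isomorphism $\mathcal End_{TV}\to Hom(TV,TW)$ (which holds when $V$ is free as a module), $g$ induces an $A_\infty$-bialgebra structure on $V$ and extends to a morphism $G=\{g_m^n\mid g_1^1=g\}:V\Rightarrow W$, uniquely up to isomorphism. Low-arity relations for the transfer from $BA$ to $H$. Write $\nabla$ for the induced differential on $Hom(TH,T(BA))$. With $\omega_H^{1,2}=\mu_H$ and $\omega_H^{2,1}=\Delta_H$, the cochain homotopies $g_2^1:H\otimes H\to BA$, $g_1^2:H\to BA\otimes BA$ and $g_2^2:H\otimes H\to BA\otimes BA$ satisfy $$\nabla g_2^1=g\mu_H+\mu(g\otimes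 g),\qquad \nabla g_1^2=\Delta g+(g\otimes g)\Delta_H,$$ $$\begin{aligned}\nabla g_2^2={}&(\mu\otimes\mu)\sigma_{2,2}\left(\Delta g\otimes g_1^2+g_1^2\otimes(g\otimes g)\Delta_H\right)\\&+\left(\mu(g\otimes g)\otimes g_2^1+g_2^1\otimes g\mu_H\right)\sigma_{2,2}(\Delta_H\otimes\Delta_H)\\&+\omega_{BA}^{2,2}(g\otimes g)+(g\otimes g)\omega_H^{2,2}+\Delta g_2^1+g_1^2\mu_H,\end{aligned}$$ where $\omega_{BA}^{2,2}(g\otimes g)=0$ since $BA$ has trivial higher order structure. The choices. Since $\mu([b]\otimes[b])=[a_2a_3]=d[a_2|a_3]$, one has $\mu_H(\beta\otimes\beta)=0$, and there is a $g_2^1$ with $g_2^1(\beta\otimes\beta)=[a_i|a_{5-i}]$ for some $i\in\{2,3\}$; one may choose $[a_2|a_3]$, since either choice gives rise to isomorphic structures. Since $\beta$ is primitive, $\nabla g_1^2(\beta)=0$, so $g_1^2(\beta)=\lambda\otimes[a_2]+[a_2]\otimes\rho$ for some $\lambda,\rho\in\mathbb{Z}_2$, and one may choose $g_1^2(\beta)=0$.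
   Formalization: g(cls[x_1|...|x_n])=[x_1|...|x_n] is required only for [ ], [a_2], [a_3], [b] (for all words it is inconsistent: [a_2a_3] is a coboundary), and the transfer is assumed strictly unital, g_2^1(1⊗h)=g_2^1(h⊗1)=0, without which the formula can fail. *)

(* Defs.v *)
From HB Require Import structures.
From mathcomp Require Import all_boot all_order all_algebra generic_quotient.
From mathcomp Require Import all_classical all_reals all_analysis.
From mathcomp Require Import wedge_sigT ring.

Set Implicit Arguments.
Unset Strict Implicit.
Unset Printing Implicit Defensive.

Import Order.TTheory GRing.Theory Num.Theory numFieldNormedType.Exports.

Local Open Scope classical_set_scope.
Local Open Scope ring_scope.
Local Open Scope quotient_scope.

Lemma F2_cases (a : 'F_2) : a = 0 \/ a = 1.
Proof. by case: a => [[|[|?]] h]//; [left|right]; apply/val_inj. Qed.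

Lemma F2_addxx (U : lmodType 'F_2) (x : U) : x + x = 0.
Proof. by rewrite -mulr2n -scaler_nat (_ : 2%:R = 0) ?scale0r//; apply/val_inj. Qed.

(** [presented rels] is the ['F_2]-module with generators [G] and relations
    [rels]; a list over [G] stands for the sum of its entries (there are no
    other coefficients over ['F_2]).  Two lists are identified when every
    assignment of the generators into a module that satisfies the relations
    gives them the same value. *)
Section Presented.
Variables (G : choiceType) (rels : set (seq G)).

Definition respects (U : lmodType 'F_2) (F : G -> U) : Prop :=
  forall r, rels r -> \sum_(x <- r) F x = 0.

Definition pres_rel (s t : seq G) : bool :=
  `[< forall (U : lmodType 'F_2) (F : G -> U), respects F ->
        \sum_(x <- s) F x = \sum_(x <- t) F x >].

Lemma pres_rel_refl : reflexive pres_rel.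
Proof. by move=> s; apply/asboolP. Qed.

Lemma pres_rel_sym : symmetric pres_rel.
Proof. by move=> s t; apply/asboolP/asboolP=> h U F /h. Qed.

Lemma pres_rel_trans : transitive pres_rel.
Proof.
by move=> t s u /asboolP h /asboolP k; apply/asboolP=> U F rF; rewrite h ?k.
Qed.

Canonical pres_equiv :=
  EquivRel pres_rel pres_rel_refl pres_rel_sym pres_rel_trans.

Definition presented := {eq_quot pres_equiv}.
HB.instance Definition _ := Choice.on presented.
HB.instance Definition _ := EqQuotient.on presented.

Definition fsum (s : seq G) : presented := \pi s.

Definition gen (x : G) : presented := fsum [:: x].

Lemma fsum_eq s t : fsum s = fsum t <->
  forall (U : lmodType 'F_2) (F : G -> U), respects F ->
    \sum_(x <- s) F x = \sum_(x <- t) F x.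
Proof. by split=> [/eqmodP/asboolP//|h]; apply/eqmodP/asboolP. Qed.

Lemma repr_fsum s (U : lmodType 'F_2) (F : G -> U) : respects F ->
  \sum_(x <- repr (fsum s)) F x = \sum_(x <- s) F x.
Proof. by move=> rF; apply: (fsum_eq _ _).1 => //; rewrite /fsum reprK. Qed.

Lemma fsum_repr (x : presented) : x = fsum (repr x).
Proof. by rewrite /fsum reprK. Qed.

Definition pres_add (x y : presented) := fsum (repr x ++ repr y).
Definition pres_scale (a : 'F_2) (x : presented) :=
  if a == 0 then fsum [::] else x.

Lemma pres_addA : associative pres_add.
Proof.
move=> x y z; apply/fsum_eq => U F rF.
by rewrite !big_cat/= !repr_fsum// !big_cat/= addrA.
Qed.

Lemma pres_addC : commutative pres_add.
Proof. by move=> x y; apply/fsum_eq => U F rF; rewrite !big_cat/= addrC. Qed.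

Lemma pres_add0 : left_id (fsum [::]) pres_add.
Proof.
move=> x; rewrite [RHS]fsum_repr; apply/fsum_eq => U F rF.
by rewrite big_cat/= repr_fsum// big_nil add0r.
Qed.

Lemma pres_addN : left_inverse (fsum [::]) idfun pres_add.
Proof.
by move=> x; apply/fsum_eq => U F rF; rewrite big_cat/= F2_addxx big_nil.
Qed.

HB.instance Definition _ := GRing.isZmodule.Build presented
  pres_addA pres_addC pres_add0 pres_addN.

Lemma fsum0 : fsum [::] = 0 :> presented. Proof. by []. Qed.

Lemma pres_scaleA (a b : 'F_2) x :
  pres_scale a (pres_scale b x) = pres_scale (a * b) x.
Proof.
by rewrite /pres_scale; case: (F2_cases a) => ->; rewrite ?mul0r ?mul1r ?eqxx.
Qed.

Lemma pres_scale1 : left_id 1 pres_scale. Proof. by []. Qed.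

Lemma pres_scaleDr : right_distributive pres_scale +%R.
Proof.
by move=> a x y; rewrite /pres_scale fsum0; case: eqP => // _; rewrite addr0.
Qed.

Lemma pres_scaleDl v : {morph pres_scale^~ v : a b / a + b}.
Proof.
move=> a b; rewrite /pres_scale fsum0.
case: (F2_cases a) => ->; case: (F2_cases b) => ->;
  rewrite ?addr0 ?add0r ?eqxx//=.
by rewrite (addNr v : v + v = 0).
Qed.

HB.instance Definition _ := GRing.Zmodule_isLmodule.Build 'F_2 presented
  pres_scaleA pres_scale1 pres_scaleDr pres_scaleDl.

(** The linear map with prescribed values on the generators (and, by
    convention, [0] if these values violate the relations). *)
Section Lift.
Variables (U : lmodType 'F_2) (F : G -> U).

Definition plift (x : presented) : U :=
  if `[< respects F >] then \sum_(g <- repr x) F g else 0.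

Lemma plift_is_linear : linear plift.
Proof.
move=> a x y; rewrite /plift; case: asboolP => [rF|_]; last first.
  by rewrite scaler0 addr0.
rewrite repr_fsum// big_cat/=; congr +%R; rewrite [a *: x]/(pres_scale a x).
rewrite /pres_scale; case: (F2_cases a) => ->; rewrite ?eqxx ?scale1r ?scale0r//.
by rewrite repr_fsum// big_nil.
Qed.

HB.instance Definition _ :=
  GRing.isLinear.Build 'F_2 presented U _ plift plift_is_linear.

Lemma plift_gen g : respects F -> plift (gen g) = F g.
Proof. by move=> rF; rewrite /plift asboolT// repr_fsum// big_seq1. Qed.

End Lift.
End Presented.
Arguments gen {G} rels x.
Arguments plift {G rels U} F x.

Section Tensor.
Variables V W : lmodType 'F_2.

Definition tens_rels : set (seq (V * W)) :=
  [set r | (exists v v' w, r = [:: (v + v', w); (v, w); (v', w)]) \/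
           (exists v w w', r = [:: (v, w + w'); (v, w); (v, w')])].

Definition tens := presented tens_rels.
HB.instance Definition _ := GRing.Lmodule.on tens.

Definition tn (v : V) (w : W) : tens := gen tens_rels (v, w).

Definition tlift (U : lmodType 'F_2) (F : V -> W -> U) : tens -> U :=
  plift (fun p => F p.1 p.2).
HB.instance Definition _ (U : lmodType 'F_2) (F : V -> W -> U) :=
  GRing.Linear.copy (tlift F) (plift (fun p => F p.1 p.2)).

End Tensor.
Infix "⊗" := tn (at level 40, left associativity).

Section TensorMaps.
Variables U V W : lmodType 'F_2.

Definition tmap (U' V' : lmodType 'F_2) (f : U -> U') (g : V -> V') :
  tens U V -> tens U' V' := tlift (fun u v => f u ⊗ g v).

Definition tassoc : tens (tens U V) W -> tens U (tens V W) :=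
  tlift (fun x w => tlift (fun u v => u ⊗ (v ⊗ w)) x).

Definition sigma22 (V1 V2 V3 V4 : lmodType 'F_2) :
  tens (tens V1 V2) (tens V3 V4) -> tens (tens V1 V3) (tens V2 V4) :=
  tlift (fun x y =>
    tlift (fun a b => tlift (fun c e => (a ⊗ c) ⊗ (b ⊗ e)) y) x).

End TensorMaps.

Definition tdiff (U : lmodType 'F_2) (d : U -> U) (x : tens U U) : tens U U :=
  tmap d id x + tmap id d x.

(** [tpow V n] is [V^{⊗n}], with [V^{⊗1}] and [V^{⊗2}] convertible to [V] and
    [tens V V]. *)
Fixpoint tpow (V : lmodType 'F_2) (n : nat) : lmodType 'F_2 :=
  match n with
  | 0 => ('F_2)^o
  | m.+1 => match m with 0 => V | _ => tens V (tpow V m) end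
  end.

Section DirectSum.
Variable M : nat -> lmodType 'F_2.

Definition dsum_rels : set (seq {n : nat & M n}) :=
  [set r | exists n (x y : M n),
     r = [:: existT _ n (x + y); existT _ n x; existT _ n y]].

Definition dsum := presented dsum_rels.
HB.instance Definition _ := GRing.Lmodule.on dsum.

Definition dinc n (x : M n) : dsum := gen dsum_rels (existT _ n x).

End DirectSum.

(** [bar_word [:: x1; ...; xn]] is [[x1|...|xn]]; the relations are
    multilinearity in each letter. *)
Section TensorModule.
Variable V : lmodType 'F_2.

Definition talg_rels : set (seq (seq V)) :=
  [set r | exists s t (x y : V),
     r = [:: s ++ (x + y) :: t; s ++ x :: t; s ++ y :: t]].

Definition talg := presented talg_rels.
HB.instance Definition _ := GRing.Lmodule.on talg.

Definition bar_word (w : seq V) : talg := gen talg_rels w.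

End TensorModule.

Section Homology.
Variables (U V W : lmodType 'F_2) (d0 : {linear U -> V}) (d1 : {linear V -> W}).

Definition cocycle_pred : {pred V} := [pred v | d1 v == 0].

Lemma cocycle_pred_submod : submod_closed cocycle_pred.
Proof.
split=> [|a x y]; rewrite !inE ?linear0// linearP => /eqP-> /eqP->.
by rewrite scaler0 addr0.
Qed.

HB.instance Definition _ :=
  GRing.isSubmodClosed.Build 'F_2 V cocycle_pred cocycle_pred_submod.

Record cocycle := Cocycle {cocycle_val :> V; _ : cocycle_val \in cocycle_pred}.
HB.instance Definition _ := [isSub for cocycle_val].
HB.instance Definition _ := [Choice of cocycle by <:].
HB.instance Definition _ := [SubChoice_isSubLmodule of cocycle by <:].

Lemma cocycle_valD (x y : cocycle) : val (x + y) = val x + val y.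
Proof. exact: raddfD. Qed.

Lemma cocycle_valN (x : cocycle) : val (- x) = - val x.
Proof. exact: raddfN. Qed.

Lemma cocycle_valZ a (x : cocycle) : val (a *: x) = a *: val x.
Proof. exact: linearZ. Qed.

Definition cohomologous (x y : cocycle) : bool :=
  `[< exists u, val x - val y = d0 u >].

Lemma cohomologous_refl : reflexive cohomologous.
Proof. by move=> x; apply/asboolP; exists 0; rewrite subrr linear0. Qed.

Lemma cohomologous_sym : symmetric cohomologous.
Proof.
by move=> x y; apply/asboolP/asboolP => -[u e]; exists (- u);
  rewrite linearN -e opprB.
Qed.

Lemma cohomologous_trans : transitive cohomologous.
Proof.
move=> y x z /asboolP[u e] /asboolP[u' e']; apply/asboolP; exists (u + u').
by rewrite linearD -e -e' addrA subrK.
Qed.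

Canonical cohomologous_equiv :=
  EquivRel cohomologous cohomologous_refl cohomologous_sym cohomologous_trans.

Definition homology := {eq_quot cohomologous_equiv}.
HB.instance Definition _ := Choice.on homology.
HB.instance Definition _ := EqQuotient.on homology.

Definition hpi (x : cocycle) : homology := \pi x.

Lemma hpi_eq x y : hpi x = hpi y <-> exists u, val x - val y = d0 u.
Proof. by split=> [/eqmodP/asboolP//|h]; apply/eqmodP/asboolP. Qed.

Lemma repr_hpi x : exists u, val (repr (hpi x)) = val x + d0 u.
Proof.
have [u e] : exists u, val (repr (hpi x)) - val x = d0 u.
  by apply/hpi_eq; rewrite /hpi reprK.
by exists u; rewrite -e addrC subrK.
Qed.

Definition hom_add (x y : homology) := hpi (repr x + repr y).
Definition hom_opp (x : homology) := hpi (- repr x).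
Definition hom_scale (a : 'F_2) (x : homology) := hpi (a *: repr x).

Lemma hom_addE x y : hom_add (hpi x) (hpi y) = hpi (x + y).
Proof.
have [u e] := repr_hpi x; have [v e'] := repr_hpi y.
apply/hpi_eq; exists (u + v); 
  rewrite cocycle_valD e e' linearD cocycle_valD.
by rewrite addrACA [LHS]addrAC subrr add0r.
Qed.

Lemma hom_oppE x : hom_opp (hpi x) = hpi (- x).
Proof.
have [u e] := repr_hpi x; apply/hpi_eq; exists (- u).
by rewrite !cocycle_valN (linearN d0) e opprD opprK [LHS]addrAC addNr add0r.
Qed.

Lemma hom_scaleE a x : hom_scale a (hpi x) = hpi (a *: x).
Proof.
have [u e] := repr_hpi x; apply/hpi_eq; exists (a *: u).
by rewrite !cocycle_valZ [d0 _]linearZ e scalerDr [LHS]addrAC subrr add0r.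
Qed.

Lemma hpi_repr x : x = hpi (repr x). Proof. by rewrite /hpi reprK. Qed.

Lemma hom_addA : associative hom_add.
Proof.
by move=> x y z; rewrite (hpi_repr x) (hpi_repr y) (hpi_repr z) !hom_addE addrA.
Qed.

Lemma hom_addC : commutative hom_add.
Proof. by move=> x y; rewrite /hom_add addrC. Qed.

Lemma hom_add0 : left_id (hpi 0) hom_add.
Proof. by move=> x; rewrite (hpi_repr x) hom_addE add0r. Qed.

Lemma hom_addN : left_inverse (hpi 0) hom_opp hom_add.
Proof. by move=> x; rewrite (hpi_repr x) hom_oppE hom_addE addNr. Qed.

HB.instance Definition _ := GRing.isZmodule.Build homology
  hom_addA hom_addC hom_add0 hom_addN.

Lemma hom_scaleA a b x : hom_scale a (hom_scale b x) = hom_scale (a * b) x.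
Proof. by rewrite (hpi_repr x) !hom_scaleE scalerA. Qed.

Lemma hom_scale1 : left_id 1 hom_scale.
Proof. by move=> x; rewrite (hpi_repr x) hom_scaleE scale1r. Qed.

Lemma hom_scaleDr : right_distributive hom_scale +%R.
Proof.
move=> a x y; rewrite (hpi_repr x) (hpi_repr y) -[+%R]/hom_add.
by rewrite !(hom_addE, hom_scaleE) scalerDr.
Qed.

Lemma hom_scaleDl v : {morph hom_scale^~ v : a b / a + b}.
Proof.
move=> a b; rewrite (hpi_repr v) -[X in _ = X]/(hom_add _ _).
by rewrite !(hom_addE, hom_scaleE) scalerDl.
Qed.

HB.instance Definition _ := GRing.Zmodule_isLmodule.Build 'F_2 homology
  hom_scaleA hom_scale1 hom_scaleDr hom_scaleDl.

(** [cls v] is [0] when [v] is not a cocycle. *)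
Definition cls (v : V) : homology := hpi (insubd (0 : cocycle) v).

Definition hrep (x : homology) : V := val (repr x).

End Homology.
Arguments cls {U V W d0 d1} v.
Arguments hpi {U V W d0 d1} x.

Section Simplices.
Variable R : realType.
Implicit Types X Y : topologicalType.

Definition std_simplex n : set 'rV[R]_n.+1 :=
  [set t | (forall i, 0 <= t 0 i) /\ \sum_i t 0 i = 1].

Arguments std_simplex n : clear implicits.

Definition Simplex n : topologicalType := set_type (std_simplex n).

Definition vertex_row m n (f : 'I_m.+1 -> 'I_n.+1) (t : 'rV[R]_m.+1) :
  'rV[R]_n.+1 := \row_j \sum_(i | f i == j) t 0 i.

Lemma vertex_row_simplex m n (f : 'I_m.+1 -> 'I_n.+1) (t : Simplex m) :
  vertex_row f (val t) \in std_simplex n.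
Proof.
case: t => t /= /set_mem [t0 t1]; apply/mem_set; split.
  by move=> j; rewrite mxE; apply: sumr_ge0.
rewrite -t1 (partition_big f predT)//=.
by apply: eq_bigr => j _; rewrite mxE.
Qed.

Definition vertex_map m n (f : 'I_m.+1 -> 'I_n.+1) (t : Simplex m) : Simplex n :=
  exist (fun u => u \in std_simplex n) _ (vertex_row_simplex f t).

Lemma vertex_row_continuous m n (f : 'I_m.+1 -> 'I_n.+1) :
  continuous (vertex_row f).
Proof.
move=> t A [P Pn PA].
suff : nbhs t [set u | forall i j, P i j (vertex_row f u i j)].
  by apply: filterS => u Pu; apply: PA.
have Ft := nbhs_filter t.
apply: (@filter_forall _ _ (fun i u => forall j, P i j (vertex_row f u i j)) _ Ft).
move=> i.
apply: (@filter_forall _ _ (fun j u => P i j (vertex_row f u i j)) _ Ft) => j.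
suff h : continuous (fun u => vertex_row f u i j) by exact: (h t _ (Pn i j)).
have -> : (fun u => vertex_row f u i j) =
    (fun u : 'rV[R]_m.+1 => \sum_(k | f k == j) u 0 k).
  by apply/funext => u; rewrite mxE.
apply: continuous_big => [x|k _]; first exact: add_continuous.
exact: coord_continuous.
Qed.

Lemma vertex_map_continuous m n (f : 'I_m.+1 -> 'I_n.+1) :
  continuous (vertex_map f).
Proof.
apply: (@continuous_comp_initial _ _ _ set_val (vertex_map f)) => t.
apply: (@continuous_comp _ _ _ (set_val : Simplex m -> _) (vertex_row f)).
  exact: initial_continuous.
exact: vertex_row_continuous.
Qed.

HB.instance Definition _ m n (f : 'I_m.+1 -> 'I_n.+1) :=
  @isContinuous.Build _ _ (vertex_map f) (@vertex_map_continuous m n f).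

Definition sing X n := continuousType (Simplex n) X.

Definition face X m n (f : 'I_m.+1 -> 'I_n.+1) (s : sing X n) : sing X m :=
  (s \o vertex_map f : continuousType _ _).

Definition cochain X n : lmodType 'F_2 := sing X n -> ('F_2)^o.

Definition coboundary X n (c : cochain X n) : cochain X n.+1 :=
  fun s => \sum_(i < n.+2) c (face (lift i) s).

Lemma coboundary_is_linear X n : linear (@coboundary X n).
Proof.
move=> a c e; apply/funext => s.
change (\sum_(i < n.+2) (a *: c (face (lift i) s) + e (face (lift i) s)) =
  a *: (\sum_(i < n.+2) c (face (lift i) s)) +
  \sum_(i < n.+2) e (face (lift i) s)).
by rewrite scaler_sumr -big_split.
Qed.

HB.instance Definition _ X n :=
  GRing.isLinear.Build 'F_2 (cochain X n) (cochain X n.+1) _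
    (@coboundary X n) (@coboundary_is_linear X n).

Definition cochain_pred X n : lmodType 'F_2 :=
  if n is m.+1 then cochain X m else cochain X 0.

Definition coboundary_pred X n : {linear cochain_pred X n -> cochain X n} :=
  match n with
  | 0 => (\0 : {linear cochain X 0 -> cochain X 0})
  | m.+1 => (@coboundary X m : {linear cochain X m -> cochain X m.+1})
  end.

Definition coh X n : lmodType 'F_2 :=
  homology (coboundary_pred X n) (@coboundary X n).

Definition pullback_cochain X Y (f : continuousType X Y) n (c : cochain Y n) :
  cochain X n := fun s => c (f \o s : continuousType _ _).

Definition coh_map X Y (f : continuousType X Y) n (x : coh Y n) : coh X n :=
  cls (pullback_cochain f (hrep x)).

Definition cup_cochain X p q (c : cochain X p) (e : cochain X q) :
  cochain X (p + q) :=
  fun s => c (face (fun i => inord i) s) * e (face (fun i => inord (p + i)) s).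

Definition cup X p q (x : coh X p) (y : coh X q) : coh X (p + q) :=
  cls (cup_cochain (hrep x) (hrep y)).

(** Steenrod's [⌣_1] of cochains [c], [e] of degrees [p + 1], [q + 1]; on a
    simplex with vertices [0, ..., p + q + 1] it is
    [\sum_i c(0, ..., i, i + q + 1, ..., p + q + 1) * e(i, ..., i + q + 1)]. *)
Definition cup1_cochain X p q (c : cochain X p.+1) (e : cochain X q.+1) :
  cochain X (p + q).+1 :=
  fun s => \sum_(i < p.+1)
    c (face (fun k => inord (if (k <= i)%N then k : nat else k + q)%N) s) *
    e (face (fun k => inord (i + k)) s).

(** The Steenrod square [Sq^p] of a class [x] of degree [p + 1], that is, the
    class of [x ⌣_1 x]. *)
Definition Sq_cup1 X p (x : coh X p.+1) : coh X (p + p).+1 :=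
  cls (cup1_cochain (hrep x) (hrep x)).

Definition Sq2 X (x : coh X 3) : coh X 5 := @Sq_cup1 X 2 x.

End Simplices.
Arguments coh R X n : clear implicits.

Section Collapse.
Variables (T : topologicalType) (S : set T).

Definition collapse_rel (x y : T) : bool := `[< x = y \/ (S x /\ S y) >].

Lemma collapse_rel_refl : reflexive collapse_rel.
Proof. by move=> x; apply/asboolP; left. Qed.

Lemma collapse_rel_sym : symmetric collapse_rel.
Proof.
by move=> x y; apply/asboolP/asboolP => -[->|[]]; by [left|right].
Qed.

Lemma collapse_rel_trans : transitive collapse_rel.
Proof.
move=> y x z /asboolP[->//|[Sx Sy]] /asboolP[<-|[_ Sz]]; apply/asboolP;
  by right.
Qed.

Canonical collapse_equiv :=
  EquivRel collapse_rel collapse_rel_refl collapse_rel_sym collapse_rel_trans.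

Definition collapse : topologicalType :=
  quotient_topology {eq_quot collapse_equiv}.

Definition collapse_pi (x : T) : collapse := \pi_({eq_quot collapse_equiv}) x.

End Collapse.

Section Spaces.
Variable R : realType.

Definition unit_itv : topologicalType := set_type (`[0, 1]%classic : set R).

Lemma unit_itv0_subproof : (0 : R) \in (`[0, 1]%classic : set R).
Proof. by apply/mem_set; rewrite /= in_itv/= lexx ler01. Qed.

Lemma unit_itv1_subproof : (1 : R) \in (`[0, 1]%classic : set R).
Proof. by apply/mem_set; rewrite /= in_itv/= lexx ler01. Qed.

Definition I0 : unit_itv := exist (fun t => t \in _) _ unit_itv0_subproof.
Definition I1 : unit_itv := exist (fun t => t \in _) _ unit_itv1_subproof.

Definition sphere_set n : set 'rV[R]_n.+1 :=
  [set x | \sum_i x 0 i ^+ 2 = 1].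
Arguments sphere_set n : clear implicits.

Definition sphere n : topologicalType := set_type (sphere_set n).

Lemma sphere_base_subproof n : delta_mx 0 0 \in sphere_set n.
Proof.
apply/mem_set; rewrite /sphere_set/= (bigD1 ord0)//= mxE !eqxx expr1n.
by rewrite big1 ?addr0// => i /negPf i0; rewrite mxE i0 andbF expr0n.
Qed.

Definition sphere_base n : sphere n :=
  exist (fun t => t \in _) _ (sphere_base_subproof n).

Definition suspension_set (T : topologicalType) (t0 : T) :
  set (T * unit_itv)%type :=
  [set q | q.1 = t0 \/ q.2 = I0 \/ q.2 = I1].

Definition suspension (T : topologicalType) (t0 : T) : topologicalType :=
  collapse (suspension_set t0).

Definition suspension_base (T : topologicalType) (t0 : T) : suspension t0 :=
  collapse_pi (suspension_set t0) (t0, I0).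

(** [CP^2] is the quotient of the unit sphere of [C^3] by the unit complex
    numbers [c + s i]; a vector of [C^3] is the pair of its real and imaginary
    parts. *)
Definition S5_set : set ('rV[R]_3 * 'rV[R]_3)%type :=
  [set z : 'rV[R]_3 * 'rV[R]_3 | \sum_i (z.1 0 i ^+ 2 + z.2 0 i ^+ 2) = 1].

Definition S5 : topologicalType := set_type S5_set.

Definition CP2_rel (z w : S5) : bool :=
  `[< exists c s : R, [/\ c ^+ 2 + s ^+ 2 = 1,
        (val w).1 = c *: (val z).1 - s *: (val z).2 &
        (val w).2 = s *: (val z).1 + c *: (val z).2] >].

Lemma CP2_rel_refl : reflexive CP2_rel.
Proof.
move=> z; apply/asboolP; exists 1, 0.
by rewrite !scale1r !scale0r subr0 add0r expr1n expr0n addr0.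
Qed.

Lemma CP2_rel_sym_subproof z w : CP2_rel z w -> CP2_rel w z.
Proof.
move=> /asboolP[c [s [cs e1 e2]]]; apply/asboolP; exists c, (- s).
rewrite sqrrN e1 e2; split=> //; apply/rowP => i; rewrite !mxE.
  by rewrite -[LHS]mul1r -cs; ring.
by rewrite -[LHS]mul1r -cs; ring.
Qed.

Lemma CP2_rel_sym : symmetric CP2_rel.
Proof. by move=> z w; apply/idP/idP; exact: CP2_rel_sym_subproof. Qed.

Lemma CP2_rel_trans : transitive CP2_rel.
Proof.
move=> w z u /asboolP[c [s [cs e1 e2]]] /asboolP[c' [s' [cs' e1' e2']]].
apply/asboolP; exists (c' * c - s' * s), (s' * c + c' * s).
rewrite e1' e2' e1 e2; split; last 2 first.
- by apply/rowP => i; rewrite !mxE; ring.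
- by apply/rowP => i; rewrite !mxE; ring.
by rewrite -[RHS]mul1r -{1}cs -cs'; ring.
Qed.

Canonical CP2_equiv := EquivRel CP2_rel CP2_rel_refl CP2_rel_sym CP2_rel_trans.

Definition CP2 : topologicalType := quotient_topology {eq_quot CP2_equiv}.

Lemma S5_base_subproof : (delta_mx 0 0, 0) \in S5_set.
Proof.
apply/mem_set; rewrite /S5_set/= (bigD1 ord0)//= !mxE !eqxx expr1n expr0n.
by rewrite big1 ?addr0// => i /negPf i0; rewrite !mxE i0 andbF !expr0n addr0.
Qed.

Definition S5_base : S5 := exist (fun t => t \in _) _ S5_base_subproof.

Definition CP2_base : CP2 := \pi_({eq_quot CP2_equiv}) S5_base.

(** [wedge2 a b] is the wedge of two spaces at the points [a] and [b]; the
    maps out of it collapse one of the summands. *)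
Section Wedge2.
Variables (A B : topologicalType) (a : A) (b : B).

Definition wedge2_space (i : bool) : topologicalType := if i then A else B.
Definition wedge2_pt (i : bool) : wedge2_space i :=
  match i with true => a | false => b end.
Definition wedge2 : topologicalType := wedge wedge2_pt.

Definition wedge2_fst_fun (i : bool) : wedge2_space i -> A :=
  match i with true => id | false => fun=> a end.
Definition wedge2_snd_fun (i : bool) : wedge2_space i -> B :=
  match i with true => fun=> b | false => id end.

Definition wedge2_fst : wedge2 -> A := wedge_fun wedge2_fst_fun.
Definition wedge2_snd : wedge2 -> B := wedge_fun wedge2_snd_fun.

Lemma wedge2_fst_continuous : continuous wedge2_fst.
Proof.
apply: wedge_fun_continuous; last by move=> [] [].
by move=> [] x; [exact: cvg_id|exact: cvg_cst].
Qed.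

Lemma wedge2_snd_continuous : continuous wedge2_snd.
Proof.
apply: wedge_fun_continuous; last by move=> [] [].
by move=> [] x; [exact: cvg_cst|exact: cvg_id].
Qed.

HB.instance Definition _ :=
  @isContinuous.Build _ _ wedge2_fst wedge2_fst_continuous.
HB.instance Definition _ :=
  @isContinuous.Build _ _ wedge2_snd wedge2_snd_continuous.

End Wedge2.

Definition SigmaCP2 : topologicalType := suspension CP2_base.

Definition Yspace : topologicalType :=
  @wedge2 (sphere 2 * sphere 3)%type SigmaCP2
    (sphere_base 2, sphere_base 3) (suspension_base CP2_base).

Definition Y_to_SigmaCP2 : continuousType Yspace SigmaCP2 :=
  (@wedge2_snd _ _ _ _ : continuousType Yspace SigmaCP2).

Lemma fst_continuous (A B : topologicalType) : continuous (@fst A B).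
Proof. by move=> x; exact: cvg_fst. Qed.

Lemma snd_continuous (A B : topologicalType) : continuous (@snd A B).
Proof. by move=> x; exact: cvg_snd. Qed.

HB.instance Definition _ (A B : topologicalType) :=
  @isContinuous.Build _ _ (@fst A B) (@fst_continuous A B).
HB.instance Definition _ (A B : topologicalType) :=
  @isContinuous.Build _ _ (@snd A B) (@snd_continuous A B).

Definition Y_to_S2 : continuousType Yspace (sphere 2) :=
  (@fst (sphere 2) (sphere 3) \o (@wedge2_fst _ _ _ _ : Yspace -> _)
    : continuousType _ _).

Definition Y_to_S3 : continuousType Yspace (sphere 3) :=
  (@snd (sphere 2) (sphere 3) \o (@wedge2_fst _ _ _ _ : Yspace -> _)
    : continuousType _ _).

(** Based homotopy of based maps [S^n -> K]; its classes are the elements of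
    [π_n(K, k)]. *)
Definition sphere_homotopic (K : topologicalType) n (k : K)
    (u v : continuousType (sphere n) K) : Prop :=
  exists h : continuousType (sphere n * unit_itv)%type K,
    [/\ forall x, h (x, I0) = u x, forall x, h (x, I1) = v x &
        forall t, h (sphere_base n, t) = k].

(** A [K(Z_2, n)]: [π_m] is trivial for all [m <> n] (including [m = 0]), and
    [π_n] has exactly two elements, hence is the group [Z_2]. *)
Definition is_K_Z2 (K : topologicalType) (n : nat) : Prop :=
  forall k : K,
    (forall m, m <> n -> forall u v : continuousType (sphere m) K,
       u (sphere_base m) = k -> v (sphere_base m) = k ->
       sphere_homotopic k u v) /\
    (exists u v : continuousType (sphere n) K,
       [/\ u (sphere_base n) = k, v (sphere_base n) = k,
           ~ sphere_homotopic k u v &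
           forall w : continuousType (sphere n) K, w (sphere_base n) = k ->
             sphere_homotopic k w u \/ sphere_homotopic k w v]).

(** The path fibration [LK -> K] is [path_end], evaluation at [1]. *)
Definition path_set (K : topologicalType) (k0 : K) :
  set {compact-open, unit_itv -> K} :=
  [set c | continuous (c : unit_itv -> K) /\ c I0 = k0].

Definition path_space (K : topologicalType) (k0 : K) : topologicalType :=
  set_type (path_set k0).

Definition path_end (K : topologicalType) (k0 : K) (c : path_space k0) : K :=
  (val c : unit_itv -> K) I1.

Section Pullback.
Variables (Y E K : topologicalType) (f : Y -> K) (q : E -> K).

Definition pullback_set : set (Y * E)%type := [set z | f z.1 = q z.2].
Definition pullback_space : topologicalType := set_type pullback_set.
Definition pullback_proj (z : pullback_space) : Y := (val z).1.

Lemma pullback_proj_continuous : continuous pullback_proj.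
Proof.
move=> z; apply: (@continuous_comp _ _ _ (set_val : pullback_space -> _) fst).
  exact: initial_continuous.
exact: cvg_fst.
Qed.

HB.instance Definition _ :=
  @isContinuous.Build _ _ pullback_proj pullback_proj_continuous.

End Pullback.

Definition Xspace (K : topologicalType) (k0 : K)
    (f : continuousType Yspace K) : topologicalType :=
  pullback_space f (@path_end K k0).

Definition Xproj (K : topologicalType) (k0 : K)
    (f : continuousType Yspace K) : continuousType (Xspace k0 f) Yspace :=
  (@pullback_proj _ _ _ f (@path_end K k0) : continuousType _ _).

End Spaces.

(** [dV k x] reads "[x] is homogeneous of degree [k]". *)
Definition grading (V : lmodType 'F_2) := nat -> V -> Prop.

Definition grading_tens (V W : lmodType 'F_2) (dV : grading V) (dW : grading W) :
    grading (tens V W) := fun k x =>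
  exists s : seq (V * W), x = \sum_(p <- s) p.1 ⊗ p.2 /\
    forall p, p \in s -> exists i j, [/\ (i + j)%N = k, dV i p.1 & dW j p.2].

Fixpoint grading_tpow (V : lmodType 'F_2) (dV : grading V) (n : nat) :
    grading (tpow V n) :=
  match n return grading (tpow V n) with
  | 0 => fun k _ => k = 0
  | m.+1 => match m return grading (tpow V m) -> grading (tpow V m.+1) with
            | 0 => fun _ => dV
            | _ => fun dm => grading_tens dV dm
            end (@grading_tpow V dV m)
  end.

(** [f] lowers the degree by [k] (and vanishes in degrees below [k]). *)
Definition lowers_degree (V W : lmodType 'F_2) (dV : grading V) (dW : grading W)
    (k : nat) (f : V -> W) : Prop :=
  forall i x, dV i x -> if (k <= i)%N then dW (i - k)%N (f x) else f x = 0.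

Inductive word_degree (V : lmodType 'F_2) (dV : grading V) :
    nat -> seq V -> Prop :=
  | word_degree_nil : word_degree dV 0 [::]
  | word_degree_cons n k x w : dV n x -> word_degree dV k w ->
      word_degree dV (n + k) (x :: w).

Definition grading_talg (V : lmodType 'F_2) (dV : grading V) :
    grading (talg V) := fun k x =>
  exists s : seq (seq V), x = \sum_(w <- s) bar_word w /\
    forall w, w \in s -> word_degree dV k w.

(** [V] is the desuspension of the augmentation ideal of an algebra with zero
    differential, and [mul] is the multiplication of that ideal. *)
Section Bar.
Variables (V : lmodType 'F_2) (mul : V -> V -> V).
Let B := talg V.

Fixpoint bar_contract (w : seq V) : seq (seq V) :=
  match w with
  | x :: w' =>
    match w' with
    | y :: w'' => (mul x y :: w'') :: [seq x :: t | t <- bar_contract w']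
    | [::] => [::]
    end
  | [::] => [::]
  end.

Definition bar_d : B -> B :=
  plift (fun w => \sum_(t <- bar_contract w) bar_word t).
HB.instance Definition _ := GRing.Linear.copy bar_d
  (plift (fun w => \sum_(t <- bar_contract w) bar_word t)).

Definition bar_Delta : B -> tens B B :=
  plift (fun w => \sum_(i < (size w).+1) bar_word (take i w) ⊗ bar_word (drop i w)).

Definition bar_unit : B := bar_word [::].

Definition bar_counit : B -> ('F_2)^o := plift (fun w => (w == [::])%:R).

(** The multiplication [μ] determined by [φ].  On generators, [BA ⊗ BA] is
    spanned by the pairs [(u, v)] standing for [[u] ⊗ [v]]; [psi_bar] lists the
    terms of the reduced coproduct of such a pair, and [psi_bar_iter k] those of
    [\bar ψ^{(k)}].  The terms with [k >= size u + size v] vanish, and the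
    sum is extended by [μ([ ] ⊗ [ ]) = [ ]]. *)
Section Mu.
Variable phi : tens B B -> V.

Definition word2_size (p : seq V * seq V) : nat := (size p.1 + size p.2)%N.

Definition psi_bar (p : seq V * seq V) :
    seq ((seq V * seq V) * (seq V * seq V)) :=
  [seq q <- [seq ((take i p.1, take j p.2), (drop i p.1, drop j p.2))
              | i <- iota 0 (size p.1).+1, j <- iota 0 (size p.2).+1]
     | (0 < word2_size q.1)%N && (0 < word2_size q.2)%N].

Definition psi_bar_head (s : seq (seq V * seq V)) : seq (seq (seq V * seq V)) :=
  if s is p :: s' then [seq [:: q.1, q.2 & s'] | q <- psi_bar p] else [::].

Definition psi_bar_iter (k : nat) (p : seq V * seq V) :
    seq (seq (seq V * seq V)) :=
  iter k (fun S => flatten [seq psi_bar_head s | s <- S]) [:: [:: p]].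

Definition mu_word (p : seq V * seq V) : B :=
  if word2_size p == 0%N then bar_unit
  else \sum_(k < word2_size p) \sum_(s <- psi_bar_iter k p)
         bar_word [seq phi (bar_word q.1 ⊗ bar_word q.2) | q <- s].

Definition bar_mu : tens B B -> B :=
  tlift (fun x y => plift (fun u => plift (fun v => mu_word (u, v)) y) x).

End Mu.
End Bar.

Record is_DG_Hopf (C : lmodType 'F_2) (d : C -> C) (Delta : C -> tens C C)
    (mu : tens C C -> C) (one : C) (eps : C -> ('F_2)^o) : Prop := {
  DG_Hopf_dd : forall x, d (d x) = 0;
  DG_Hopf_d_one : d one = 0;
  DG_Hopf_eps_d : forall x, eps (d x) = 0;
  DG_Hopf_coassoc : forall x,
    tassoc (tmap Delta id (Delta x)) = tmap id Delta (Delta x);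
  DG_Hopf_counitl : forall x, tlift (fun y z => eps y *: z) (Delta x) = x;
  DG_Hopf_counitr : forall x, tlift (fun y z => eps z *: y) (Delta x) = x;
  DG_Hopf_Delta_d : forall x, Delta (d x) = tdiff d (Delta x);
  DG_Hopf_assoc : forall x y z, mu (mu (x ⊗ y) ⊗ z) = mu (x ⊗ mu (y ⊗ z));
  DG_Hopf_unitl : forall x, mu (one ⊗ x) = x;
  DG_Hopf_unitr : forall x, mu (x ⊗ one) = x;
  DG_Hopf_mu_d : forall x, d (mu x) = mu (tdiff d x);
  DG_Hopf_Delta_mu : forall x,
    Delta (mu x) = tmap mu mu (sigma22 (tmap Delta Delta x));
  DG_Hopf_Delta_one : Delta one = one ⊗ one;
  DG_Hopf_eps_mu : forall x y, eps (mu (x ⊗ y)) = eps x * eps y;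
  DG_Hopf_eps_one : eps one = 1
}.

Section Transfer.
Variables (C : lmodType 'F_2) (d : {linear C -> C}) (dC : grading C).
Variables (Delta : C -> tens C C) (mu : tens C C -> C) (one : C).

Let H := homology d d.

Definition grading_homology : grading H := fun k h =>
  exists z, [/\ d z = 0, dC k z & h = cls z].

Definition cocycle_selecting (g : H -> C) : Prop :=
  forall h, d (g h) = 0 /\ cls (g h) = h.

Definition product_induced (muH : tens H H -> H) : Prop :=
  forall x y : C, d x = 0 -> d y = 0 -> muH (cls x ⊗ cls y) = cls (mu (x ⊗ y)).

(** The coproduct of [H] obtained from [Delta] through the Künneth
    isomorphism: write [Delta z], up to a coboundary, as a tensor [t] of
    cocycles, and take the classes of the factors. *)
Definition coproduct_induced (DeltaH : H -> tens H H) : Prop :=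
  forall (z : cocycle d) (t : tens (cocycle d) (cocycle d)) (y : tens C C),
    Delta (val z) = tmap val val t + tdiff d y ->
    DeltaH (hpi z) = tmap hpi hpi t.

(** [omega n m] and [G n m] are the operations [ω_H^{n,m} : H^{⊗m} -> H^{⊗n}]
    and the homotopies [g_m^n : H^{⊗m} -> C^{⊗n}] of a transfer along
    [g = g_1^1].  Of the relations that make [G] a map of relative matrads, only
    those for [g_2^1], [g_1^2] and [g_2^2] are imposed; every transfer satisfies
    them.  Since [H] has zero differential, [∇ f] is the differential of the
    values of [f]; the term [ω_C^{2,2} (g ⊗ g)] of the last relation is zero,
    because [C] only has a product and a coproduct. *)
Record is_transfer (g : H -> C)
    (omega : forall n m, {linear tpow H m -> tpow H n})
    (G : forall n m, {linear tpow H m -> tpow C n}) : Prop := {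
  transfer_omega_degree : forall n m, (0 < n)%N -> (0 < m)%N ->
    (n * m)%N <> 1%N ->
    lowers_degree (grading_tpow grading_homology (n := m))
      (grading_tpow grading_homology (n := n)) (m + n - 3) (omega n m);
  transfer_G_degree : forall n m, (0 < n)%N -> (0 < m)%N ->
    lowers_degree (grading_tpow grading_homology (n := m))
      (grading_tpow dC (n := n)) (m + n - 2) (G n m);
  transfer_G11 : forall h : H, G 1%N 1%N h = g h;
  transfer_product : product_induced (omega 1%N 2%N);
  transfer_coproduct : coproduct_induced (omega 2%N 1%N);
  transfer_12 : forall x : tens H H,
    d (G 1%N 2%N x) = g (omega 1%N 2%N x) + mu (tmap g g x);
  transfer_21 : forall h : H,
    tdiff d (G 2%N 1%N h) = Delta (g h) + tmap g g (omega 2%N 1%N h);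
  transfer_22 : forall x : tens H H,
    tdiff d (G 2%N 2%N x) =
      tmap mu mu (sigma22
        (tmap (fun h : H => Delta (g h)) (G 2%N 1%N) x +
         tmap (G 2%N 1%N) (fun h : H => tmap g g (omega 2%N 1%N h)) x)) +
      (tmap (fun y => mu (tmap g g y)) (G 1%N 2%N)
         (sigma22 (tmap (omega 2%N 1%N) (omega 2%N 1%N) x)) +
       tmap (G 1%N 2%N) (fun y : tens H H => g (omega 1%N 2%N y))
         (sigma22 (tmap (omega 2%N 1%N) (omega 2%N 1%N) x))) +
      tmap g g (omega 2%N 2%N x) + Delta (G 1%N 2%N x) +
      G 2%N 1%N (omega 1%N 2%N x);
  (* strict unitality, implicit in the evaluation of [ω_H^{2,2}]: otherwise
     [g_2^1(1 ⊗ β)] could be the cocycle [[a_2]], which would change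
     [ω_H^{2,2}(β ⊗ β)] *)
  transfer_unitl : forall h : H, G 1%N 2%N (cls one ⊗ h) = 0;
  transfer_unitr : forall h : H, G 1%N 2%N (h ⊗ cls one) = 0
}.

End Transfer.

Section CohomologyBar.
Variables (R : realType) (X : topologicalType).

(** The desuspended augmentation ideal of [H^*(X)]; [sclass x] is the letter
    of degree [n] given by a class [x] of degree [n + 1]. *)
Definition sH : lmodType 'F_2 := dsum (fun n => coh R X n.+1).

Definition sclass n (x : coh R X n.+1) : sH :=
  @dinc (fun n => coh R X n.+1) n x.

Definition grading_sH : grading sH := fun n x => exists y, x = @sclass n y.

Definition sH_mul (x y : sH) : sH :=
  plift (fun p : {n : nat & coh R X n.+1} =>
    plift (fun q : {n : nat & coh R X n.+1} =>
      @sclass (tag p + (tag q).+1) (cup (tagged p) (tagged q))) y) x.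

Definition BA : lmodType 'F_2 := talg sH.
Definition grading_BA : grading BA := grading_talg grading_sH.
Definition BA_d : {linear BA -> BA} := bar_d sH_mul.
Definition HBA : lmodType 'F_2 := homology BA_d BA_d.

(** [φ : BA ⊗ BA -> A], of degree [+1], determines the DG Hopf algebra [BA];
    its values include [φ([x] ⊗ [ ]) = φ([ ] ⊗ [x]) = x] and
    [φ([b] ⊗ [b]) = b ⌣_1 b = Sq^2 b]. *)
Record is_twisting_map (b : coh R X 3) (phi : {linear tens BA BA -> sH}) : Prop := {
  phi_degree : forall k x, grading_tens grading_BA grading_BA k x ->
    grading_sH k (phi x);
  phi_left : forall x : sH, phi (bar_word [:: x] ⊗ bar_unit sH) = x;
  phi_right : forall x : sH, phi (bar_unit sH ⊗ bar_word [:: x]) = x;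
  phi_cup1 : phi (bar_word [:: sclass b] ⊗ bar_word [:: sclass b]) =
    sclass (Sq2 b);
  phi_DG_Hopf : is_DG_Hopf BA_d (@bar_Delta sH) (bar_mu phi) (bar_unit sH)
    (@bar_counit sH)
}.

End CohomologyBar.

(* Main.v *)
Require Import Defs.
From HB Require Import structures.
From mathcomp Require Import all_boot all_order all_algebra generic_quotient.
From mathcomp Require Import all_classical all_reals all_analysis.
From mathcomp Require Import wedge_sigT zify lra.

Set Implicit Arguments.
Unset Strict Implicit.
Unset Printing Implicit Defensive.

Import Order.TTheory GRing.Theory Num.Theory numFieldNormedType.Exports.

Local Open Scope classical_set_scope.
Local Open Scope ring_scope.

(** The path fibration is null homotopic through evaluation of paths, so
    [p^* f^* iota_5 = 0], that is, [Sq^2 b = a_2 a_3] in [H^5(X)]; hence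
    [mu([b] ⊗ [b]) = [a_2 a_3] = d[a_2|a_3]].  In the relation for [g_2^2] at
    [beta ⊗ beta], the terms with [g_1^2] vanish, the terms with [g_2^1]
    contribute [[ ] ⊗ [a_2|a_3] + [a_2|a_3] ⊗ [ ]], and these cancel against
    [Delta[a_2|a_3]] up to [[a_2] ⊗ [a_3]].  So
    [(g ⊗ g)(omega^{2,2}(beta ⊗ beta) + alpha_2 ⊗ alpha_3)] is a coboundary,
    and a linear retraction of [BA] onto its cohomology shows that the argument
    is zero.

    For nontriviality, [pi_m(K) = 0] for [m = 0, 2, 3], so that [S^2] and [S^3]
    lift to [X] and [a_2], [a_3] are nonzero.  Since [g] is linear and
    [g(alpha_i) = [a_i]], no computation of products in [H^*(X)] is needed to
    conclude that [alpha_i <> 0]. *)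

(** * Presented modules and tensor products *)

(** Presented modules have no normal form, and [plift] is [0] unless its values satisfy the
    relations; so the value of a structure map on generators is available only after multilinearity
    has been checked. This is delicate for [bar_mu], because [mu_word] is an iterated sum over cuts
    of two words and the split letter has to be followed through all of them. Similarly, [cup],
    [coh_map] and [Sq2] are evaluated on chosen representatives, so independence of the choice has
    to come from cochain formulas; for [Sq2] this is [δ(c ⌣_1 e) = δc ⌣_1 e + c ⌣_1 δe + c ⌣ e + e ⌣
    c]. No basis of [BA] is at hand, so the linear retraction onto cohomology is obtained from
    Zorn's lemma. About [K] only homotopy classes of based maps from spheres are known: [π_0]
    supplies paths between arbitrary points, which are needed because the path fibration has a fixed
    base point [k0]. *)

Lemma F2_opp (U : lmodType 'F_2) (x : U) : - x = x.
Proof. by apply/eqP; rewrite eq_sym -addr_eq0 F2_addxx. Qed.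

Lemma F2_additive_linear (U V : lmodType 'F_2) (f : U -> V) :
  {morph f : x y / x + y} -> linear f.
Proof.
move=> fD a x y; rewrite fD; congr (_ + _).
have f0 : f 0 = 0 by rewrite -(F2_addxx (0 : U)) fD F2_addxx.
by case: (F2_cases a) => ->; rewrite ?scale0r ?scale1r.
Qed.

Lemma F2_triple (U : lmodType 'F_2) (x y z : U) : x + y + z = 0 <-> x = y + z.
Proof.
split=> [/eqP|->]; last by rewrite -addrA F2_addxx.
by rewrite -addrA addr_eq0 F2_opp => /eqP.
Qed.

Section PresentedEval.
Variables (G : choiceType) (rels : set (seq G)).

(** Equality in [presented] is tested against all assignments that respect the relations, and each
    of these sends a relation to [0]; no rewriting of lists is involved. *)
Lemma gen_respects : respects rels (gen rels).
Proof.
move=> r rr; have fsumE s : \sum_(x <- s) gen rels x = fsum rels s.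
  elim: s => [|x s IH]; first by rewrite big_nil.
  rewrite big_cons IH; apply/fsum_eq => U F rF.
  by rewrite big_cat/= !repr_fsum// big_seq1 big_cons.
rewrite fsumE -[RHS]fsum0; apply/fsum_eq => U F rF.
by rewrite big_nil rF.
Qed.

Lemma gen_span (x : presented rels) : exists s, x = \sum_(y <- s) gen rels y.
Proof.
exists (repr x); rewrite [LHS]fsum_repr.
elim: (repr x) => [|y s IH]; first by rewrite big_nil.
rewrite big_cons -IH; apply/fsum_eq => U F rF.
by rewrite big_cat/= !repr_fsum// big_seq1 big_cons.
Qed.

Lemma pres_linear_eq (U : lmodType 'F_2) (f g : presented rels -> U) :
  linear f -> linear g -> (forall y, f (gen rels y) = g (gen rels y)) -> f =1 g.
Proof.
move=> lf lg e x; have [s ->] := gen_span x.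
pose f' := HB.pack_for {linear presented rels -> U} f
  (GRing.isLinear.Build _ _ _ _ _ lf).
pose g' := HB.pack_for {linear presented rels -> U} g
  (GRing.isLinear.Build _ _ _ _ _ lg).
rewrite -[f]/(f' : _ -> _) -[g]/(g' : _ -> _) !linear_sum.
by apply: eq_bigr => y _; exact: e.
Qed.

Lemma plift_eqfun (U : lmodType 'F_2) (F F' : G -> U) :
  F =1 F' -> plift F =1 (plift F' : presented rels -> U).
Proof. by move=> /funext ->. Qed.

Lemma respectsD (U : lmodType 'F_2) (F F' : G -> U) :
  respects rels F -> respects rels F' -> respects rels (fun x => F x + F' x).
Proof. by move=> rF rF' r rr; rewrite big_split/= rF// rF'// addr0. Qed.

Lemma pliftD (U : lmodType 'F_2) (F F' : G -> U) (x : presented rels) :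
  respects rels F -> respects rels F' ->
  plift (fun x => F x + F' x) x = plift F x + plift F' x.
Proof.
move=> rF rF'; have rD := respectsD rF rF'.
by rewrite /plift !asboolT// big_split.
Qed.

End PresentedEval.

Section BilinearEval.
Variables (G G' : choiceType) (rels : set (seq G)) (rels' : set (seq G')).
Variables (U : lmodType 'F_2) (F : G -> G' -> U).
Hypotheses (rF : forall y, respects rels (F^~ y))
           (rF' : forall x, respects rels' (F x)).

(** Bilinear maps are built as one [plift] inside another. The relations in the outer variable are
    known only when the inner argument is a generator, so an arbitrary [y] is expanded into
    generators before the sums are exchanged. *)
Lemma plift2_respects (y : presented rels') :
  respects rels (fun x => plift (F x) y).
Proof.
move=> r rr; have [s ->] := gen_span y.
under eq_bigr do rewrite linear_sum.
rewrite exchange_big big1//= => y' _.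
under eq_bigr do rewrite plift_gen//.
exact: rF.
Qed.

Lemma plift2Dr (x : presented rels) (y y' : presented rels') :
  plift (fun x => plift (F x) (y + y')) x =
  plift (fun x => plift (F x) y) x + plift (fun x => plift (F x) y') x.
Proof.
rewrite -pliftD; try exact: plift2_respects.
by apply: plift_eqfun => x'; rewrite linearD.
Qed.

Lemma plift2_gen x y :
  plift (fun x => plift (F x) (gen rels' y)) (gen rels x) = F x y.
Proof. by rewrite plift_gen ?plift_gen//; exact: plift2_respects. Qed.

End BilinearEval.

Section TensorEval.
Variables V W : lmodType 'F_2.

Lemma tnDl (v v' : V) (w : W) : (v + v') ⊗ w = v ⊗ w + v' ⊗ w.
Proof.
have := @gen_respects _ (@tens_rels V W) [:: (v + v', w); (v, w); (v', w)].
rewrite !big_cons big_nil addr0 addrA => h; apply/F2_triple/h.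
by left; exists v, v', w.
Qed.

Lemma tnDr (v : V) (w w' : W) : v ⊗ (w + w') = v ⊗ w + v ⊗ w'.
Proof.
have := @gen_respects _ (@tens_rels V W) [:: (v, w + w'); (v, w); (v, w')].
rewrite !big_cons big_nil addr0 addrA => h; apply/F2_triple/h.
by right; exists v, w, w'.
Qed.

Lemma tn0l (w : W) : (0 : V) ⊗ w = 0.
Proof. by rewrite -(F2_addxx (0 : V)) tnDl F2_addxx. Qed.

Lemma tn0r (v : V) : v ⊗ (0 : W) = 0.
Proof. by rewrite -(F2_addxx (0 : W)) tnDr F2_addxx. Qed.

(** Biadditivity is exactly what the relations of [tens] demand over ['F_2]; without it [tlift]
    would be the zero map by default. *)
Lemma tlift_tn (U : lmodType 'F_2) (F : V -> W -> U) v w :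
  (forall w, {morph F^~ w : x y / x + y}) ->
  (forall v, {morph F v : x y / x + y}) ->
  tlift F (v ⊗ w) = F v w.
Proof.
move=> Dl Dr; rewrite /tlift /tn plift_gen// => r [].
  move=> [x [y [z ->]]]; rewrite !big_cons big_nil/= Dl addr0 -addrA.
  by rewrite addrA F2_addxx.
move=> [x [y [z ->]]]; rewrite !big_cons big_nil/= Dr addr0 -addrA.
by rewrite addrA F2_addxx.
Qed.

Lemma tens_linear_eq (U : lmodType 'F_2) (f g : tens V W -> U) :
  linear f -> linear g -> (forall v w, f (v ⊗ w) = g (v ⊗ w)) -> f =1 g.
Proof. by move=> lf lg e; apply: pres_linear_eq => // -[v w]; exact: e. Qed.

End TensorEval.

Lemma tmap_tn (U V U' V' : lmodType 'F_2) (f : U -> U') (g : V -> V') u v :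
  linear f -> linear g -> tmap f g (u ⊗ v) = f u ⊗ g v.
Proof.
move=> lf lg.
have fD : {morph f : x y / x + y} by move=> x y; have := lf 1 x y; rewrite !scale1r.
have gD : {morph g : x y / x + y} by move=> x y; have := lg 1 x y; rewrite !scale1r.
rewrite /tmap tlift_tn// => ? x y /=; first by rewrite fD tnDl.
by rewrite gD tnDr.
Qed.

HB.instance Definition _ (U V U' V' : lmodType 'F_2) (f : U -> U')
    (g : V -> V') :=
  GRing.Linear.copy (tmap f g) (tlift (fun u v => f u ⊗ g v)).

HB.instance Definition _ (V1 V2 V3 V4 : lmodType 'F_2) :=
  GRing.Linear.copy (@sigma22 V1 V2 V3 V4)
    (tlift (fun x y =>
      tlift (fun a b => tlift (fun c e => (a ⊗ c) ⊗ (b ⊗ e)) y) x)).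

Lemma tdiff_is_linear (U : lmodType 'F_2) (d : U -> U) : linear (tdiff d).
Proof. by move=> a x y; rewrite /tdiff !linearP addrACA -scalerDr. Qed.

HB.instance Definition _ (U : lmodType 'F_2) (d : U -> U) :=
  GRing.isLinear.Build 'F_2 (tens U U) (tens U U) _ (tdiff d)
    (@tdiff_is_linear U d).

Lemma tens_bilinear_respects (V W U : lmodType 'F_2) (F : V -> W -> U) :
  (forall w, {morph F^~ w : x y / x + y}) ->
  (forall v, {morph F v : x y / x + y}) ->
  respects (@tens_rels V W) (fun p => F p.1 p.2).
Proof.
move=> Dl Dr r [] [x [y [z ->]]]; rewrite !big_cons big_nil/=.
  by rewrite Dl addr0 -addrA addrA F2_addxx.
by rewrite Dr addr0 -addrA addrA F2_addxx.
Qed.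

Lemma sigma22_tn (V1 V2 V3 V4 : lmodType 'F_2) (a : V1) (b : V2) (c : V3)
    (e : V4) : sigma22 ((a ⊗ b) ⊗ (c ⊗ e)) = (a ⊗ c) ⊗ (b ⊗ e).
Proof.
(* The two inner lifts of [sigma22] form an iterated lift over pairs, so its additivity in each
   tensor argument reduces to that of [F] on pairs of generators. *)
pose F (p : V1 * V2) (q : V3 * V4) : tens (tens V1 V3) (tens V2 V4) :=
  (p.1 ⊗ q.1) ⊗ (p.2 ⊗ q.2).
have rF q : respects (@tens_rels V1 V2) (F^~ q).
  apply: (@tens_bilinear_respects _ _ _ (fun x y => F (x, y) q)) => ? x y;
    by rewrite /F/= ?tnDl ?tnDr.
have rF' p : respects (@tens_rels V3 V4) (F p).
  apply: (@tens_bilinear_respects _ _ _ (fun x y => F p (x, y))) => ? x y;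
    by rewrite /F/= ?tnDr ?tnDl ?tnDr.
rewrite /sigma22 tlift_tn; last 2 first.
- by move=> w x y; rewrite linearD.
- move=> v x y; exact: (plift2Dr rF rF').
exact: (plift2_gen rF rF' (a, b) (c, e)).
Qed.

(** * Linear extension and classes *)

Section LinearExtension.
Variables (V U : lmodType 'F_2).

(** Graph of a partially defined linear map: over ['F_2] a subset that contains [0] and is closed
    under sums is a subspace, and single-valuedness need only be required over [0]. *)
Definition functional_graph (A : set (V * U)) : Prop :=
  [/\ A (0, 0), forall s t, A s -> A t -> A (s + t) &
      forall u, A (0, u) -> u = 0].

(** Over ['F_2], adjoining [v] to the domain adds just one coset, [v] plus the old domain; the
    extension takes the value [0] at [v]. *)
Lemma functional_graph_extend (A : set (V * U)) (v : V) :
  functional_graph A -> (forall u, ~ A (v, u)) ->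
  functional_graph (A `|` [set s | A (s + (v, 0))]).
Proof.
move=> [A0 AD Af] nv.
have vv : (v, 0) + (v, 0) = 0 :> V * U.
  by rewrite -[LHS]/(v + v, 0 + 0) F2_addxx addr0.
split; first by left.
- move=> s t [As|As] [At|At]/=; [left|right|right|left].
  + exact: AD.
  + by rewrite /= -addrA; exact: AD.
  + by rewrite /= addrAC; exact: AD.
  + by have := AD _ _ As At; rewrite addrACA vv addr0.
- move=> u [/Af//|/=].
  by rewrite -[X in A X]/(0 + v, u + 0) add0r addr0 => /nv.
Qed.

Lemma linear_extension (A : set (V * U)) : functional_graph A ->
  exists f : {linear V -> U}, forall v u, A (v, u) -> f v = u.
Proof.
move=> gA.
pose P (B : set (V * U)) := B = set0 \/ (functional_graph B /\ A `<=` B).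
have [F FP Ftot|B [PB Bmax]] := @Zorn_bigcup _ P.
  have [[B0 FB0 nB0]|F0] := pselect (exists2 B, F B & B !=set0); last first.
    left; apply/seteqP; split=> // s [B FB Bs]; apply: F0.
    by exists B => //; exists s.
  have gF B s : F B -> B s -> functional_graph B /\ A `<=` B.
    by move=> FB Bs; case: (FP _ FB) => // B0E; rewrite B0E in Bs.
  case: nB0 => s0 B0s0; have [[B00 _ _] AB0] := gF _ _ FB0 B0s0.
  right; split; last by move=> s As; exists B0 => //; exact: AB0.
  split; first by exists B0.
    move=> s t [B FB Bs] [C FC Ct]; case: (Ftot _ _ FB FC) => [BC|CB].
      have [[_ CD _] _] := gF _ _ FC Ct.
      by exists C => //; apply: CD => //; exact: BC.
    have [[_ BD _] _] := gF _ _ FB Bs.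
    by exists B => //; apply: BD => //; exact: CB.
  by move=> u [B FB Bu]; have [[_ _ Bf] _] := gF _ _ FB Bu; exact: Bf.
case: PB => [B0|[gB AB]].
  exfalso; apply: (Bmax A); last by right; split.
  rewrite B0; split; first by move=> ?.
  by case: gA => A0 _ _ /(_ (0, 0) A0).
have domB v : {u | B (v, u)}.
  apply: cid; apply: contrapT => nv.
  have nv' u : ~ B (v, u) by move=> Bvu; apply: nv; exists u.
  apply: (Bmax _ _ (or_intror (conj (functional_graph_extend gB nv') _))).
    split=> [s Bs|]; first by left.
    move=> /(_ (v, 0)) h; apply: (nv' 0); apply: h; right => /=.
    rewrite -[X in B X]/(v + v, 0 + 0) F2_addxx addr0.
    by case: gB.
  by move=> s /AB; left.
case: gB => B0 BD Bf.
have Bfun v u u' : B (v, u) -> B (v, u') -> u = u'.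
  move=> Bu Bu'; have := BD _ _ Bu Bu'.
  rewrite -[X in B X]/(v + v, u + u') F2_addxx => /Bf/eqP.
  by rewrite addr_eq0 F2_opp => /eqP.
have fl : linear (fun v => projT1 (domB v)).
  apply: F2_additive_linear => x y; apply: Bfun (projT2 (domB _)) _.
  exact: (BD _ _ (projT2 (domB x)) (projT2 (domB y))).
pose f := HB.pack_for {linear V -> U} (fun v => projT1 (domB v))
  (GRing.isLinear.Build _ _ _ _ _ fl).
exists f => v u /AB; exact: Bfun (projT2 (domB v)).
Qed.

End LinearExtension.

Lemma separating_functional (V : lmodType 'F_2) (x : V) : x <> 0 ->
  exists f : {linear V -> ('F_2)^o}, f x = 1.
Proof.
move=> x0; have [|f fx] :=
    @linear_extension V ('F_2)^o [set s | s = (0, 0) \/ s = (x, 1)].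
  split; first by left.
    move=> s t [->|->] [->|->]/=; [left|right|right|left];
      apply/pair_equal_spec; rewrite /= ?addr0 ?add0r; split=> //;
      exact: F2_addxx.
  by move=> u [[]//|[/esym/x0]].
by exists f; apply: fx; right.
Qed.

(** The product of two separating functionals is a bilinear form with value [1] at the pair. *)
Lemma tn_neq0 (V W : lmodType 'F_2) (v : V) (w : W) :
  v <> 0 -> w <> 0 -> v ⊗ w <> 0.
Proof.
move=> /separating_functional[f fv] /separating_functional[h hw].
move=> /(congr1 (tlift (fun x y => f x * h y : ('F_2)^o))).
rewrite linear0 tlift_tn; first by rewrite fv hw mulr1 => /eqP; rewrite oner_eq0.
- by move=> ? x y; rewrite linearD mulrDl.
- by move=> ? x y; rewrite linearD mulrDr.
Qed.

Section HomologyClasses.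
Variables (U V W : lmodType 'F_2) (d0 : {linear U -> V}) (d1 : {linear V -> W}).
Local Notation cls := (@cls U V W d0 d1).

Lemma cls_hpi (z : cocycle d1) : cls (val z) = hpi z.
Proof. by rewrite /Defs.cls /insubd valK. Qed.

Lemma cls_cocycle (v : V) (dv : v \in cocycle_pred d1) :
  cls v = hpi (Cocycle dv).
Proof. exact: (cls_hpi (Cocycle dv)). Qed.

Lemma hpiD (x y : cocycle d1) : hpi (x + y) = hpi x + hpi y :> homology d0 d1.
Proof. by rewrite -[RHS]/(hom_add _ _) hom_addE. Qed.

Lemma clsD (v w : V) : d1 v = 0 -> d1 w = 0 -> cls (v + w) = cls v + cls w.
Proof.
move=> /eqP dv /eqP dw.
rewrite (cls_cocycle dv) (cls_cocycle dw) -hpiD -cls_hpi.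
by rewrite cocycle_valD.
Qed.

Lemma hrep_cocycle (x : homology d0 d1) : d1 (hrep x) = 0.
Proof. by have := valP (repr x); rewrite inE => /eqP. Qed.

Lemma cls_hrep (x : homology d0 d1) : cls (hrep x) = x.
Proof. by rewrite /hrep cls_hpi -hpi_repr. Qed.

Lemma cls_eq (v w : V) (u : U) : d1 v = 0 -> d1 w = 0 -> v = w + d0 u ->
  cls v = cls w.
Proof.
move=> /eqP dv /eqP dw e; rewrite (cls_cocycle dv) (cls_cocycle dw).
by apply/hpi_eq; exists u; rewrite /= e addrC addKr.
Qed.

Lemma cls0 : cls 0 = 0.
Proof.
by have := clsD (linear0 d1) (linear0 d1); rewrite addr0 F2_addxx.
Qed.

Lemma cls_coboundary (u : U) : d1 (d0 u) = 0 -> cls (d0 u) = 0.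
Proof.
by move=> dd; rewrite -cls0; apply: (cls_eq (u := u)); rewrite ?linear0 ?add0r.
Qed.

Lemma hrep_cls (v : V) : d1 v = 0 -> exists u, hrep (cls v) = v + d0 u.
Proof.
by move=> /eqP dv; rewrite (cls_cocycle dv) /hrep; exact: repr_hpi.
Qed.

(** Taking classes is linear on cocycles, hence extends to all of [V]; a coboundary then goes to its
    class, which is [0]. *)
Lemma class_retraction : (forall u, d1 (d0 u) = 0) ->
  exists f : {linear V -> homology d0 d1},
    (forall v, d1 v = 0 -> f v = cls v) /\ (forall u, f (d0 u) = 0).
Proof.
move=> dd; have [|f fE] :=
    @linear_extension V (homology d0 d1) [set s | d1 s.1 = 0 /\ s.2 = cls s.1].
  split; first by rewrite /= linear0 cls0.
    move=> [v h] [w k]/= [dv ->] [dw ->].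
    by rewrite linearD dv dw addr0 clsD.
  by move=> u [_ /=]; rewrite cls0.
exists f; split=> [v dv|u]; first exact: fE.
have -> : f (d0 u) = cls (d0 u) by apply: fE; split=> //=; exact: dd.
exact: cls_coboundary.
Qed.

End HomologyClasses.

(** * Evaluation of the transfer relations *)

Section TransferEvaluation.
Variables (C : lmodType 'F_2) (d : {linear C -> C}) (dC : grading C).
Variables (Delta : C -> tens C C) (mu : tens C C -> C) (one : C).
Hypotheses (lDelta : linear Delta) (lmu : linear mu).
Hypotheses (dd : forall x, d (d x) = 0) (d_one : d one = 0).
Local Notation H := (homology d d).
Local Notation cls := (@cls C C C d d).

(** For a primitive cocycle the tensor of cocycles that [coproduct_induced] asks for is explicit,
    and the correcting coboundary is [tdiff d 0]. *)
Lemma coproduct_induced_primitive (DeltaH : H -> tens H H) (b : C) :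
  coproduct_induced Delta DeltaH -> d b = 0 ->
  Delta b = one ⊗ b + b ⊗ one ->
  DeltaH (cls b) = cls one ⊗ cls b + cls b ⊗ cls one.
Proof.
move=> hD /eqP db Db; have /eqP d1 := d_one.
pose b' : cocycle d := Cocycle db; pose u' : cocycle d := Cocycle d1.
have lval : linear (val : cocycle d -> C) by exact: linearP.
have lhpi : linear (hpi : cocycle d -> H) by exact/F2_additive_linear/hpiD.
have := hD b' (u' ⊗ b' + b' ⊗ u') 0.
rewrite !linearD/= !tmap_tn// /tdiff !linear0 !addr0 => h.
by rewrite (cls_cocycle _ db) (cls_cocycle _ d1) h.
Qed.

(** With [f] the retraction onto cohomology, [f ∘ g] is the identity and [f ∘ d = 0]; so [f ⊗ f] is
    a left inverse of [g ⊗ g] and kills every [tdiff d y]. This replaces an appeal to the Künneth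
    isomorphism. *)
Lemma tensor_classes_eq (g : {linear H -> C}) (s t : tens H H)
    (y : tens C C) : cocycle_selecting g ->
  tmap g g s + tmap g g t = tdiff d y -> s = t.
Proof.
move=> hg e; have [f [fcls fd]] := class_retraction dd.
have lf : linear f by exact: linearP.
have lg : linear g by exact: linearP.
have ld : linear d by exact: linearP.
have fg h : f (g h) = h by have [dg clsg] := hg h; rewrite fcls.
have ffgg x : tmap f f (tmap g g x) = x.
  apply: (tens_linear_eq (f := fun x => tmap f f (tmap g g x))) => //.
    by move=> a v w; rewrite !linearP.
  by move=> v w; rewrite !tmap_tn// !fg.
have ffd x : tmap f f (tdiff d x) = 0.
  apply: (tens_linear_eq (f := fun x => tmap f f (tdiff d x)) (g := fun=> 0)).
  - by move=> a v w; rewrite !linearP.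
  - by move=> a v w; rewrite scaler0 addr0.
  by move=> v w; rewrite /tdiff !tmap_tn// linearD/= !tmap_tn// !fd tn0l tn0r addr0.
have := congr1 (tmap f f) e; rewrite linearD/= !ffgg ffd => /eqP.
by rewrite addr_eq0 F2_opp => /eqP.
Qed.

(** Modelled on [b = [b]], [a = [a_2]], [a' = [a_3]] and [c = [a_2|a_3]]: the deviation of [c] from
    primitivity, [a ⊗ a'], is what survives in the relation for [g_2^2]. *)
Lemma transfer_omega22 (g : {linear H -> C})
    (omega : forall n m, {linear tpow H m -> tpow H n})
    (G : forall n m, {linear tpow H m -> tpow C n}) (a a' b c : C) :
  is_transfer dC Delta mu one g omega G -> cocycle_selecting g ->
  d b = 0 -> mu (one ⊗ one) = one ->
  Delta b = one ⊗ b + b ⊗ one ->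
  Delta c = one ⊗ c + a ⊗ a' + c ⊗ one -> d c = mu (b ⊗ b) ->
  g (cls one) = one -> g (cls a) = a -> g (cls a') = a' ->
  G 1%N 2%N (cls b ⊗ cls b) = c -> G 2%N 1%N (cls b) = 0 ->
  omega 2%N 2%N (cls b ⊗ cls b) = cls a ⊗ cls a'.
Proof.
move=> hG hg db mu1 Db Dc dc g1 ga ga' G12bb G21b.
have [_ _ _ hmuH hDH _ _ h22 G12ul G12ur] := hG.
have DHb := coproduct_induced_primitive hDH db Db.
have muHbb : omega 1%N 2%N (cls b ⊗ cls b) = 0.
  by rewrite hmuH// -dc cls_coboundary.
have muH11 : omega 1%N 2%N (cls one ⊗ cls one) = cls one.
  by rewrite hmuH// mu1.
have := h22 (cls b ⊗ cls b); move: hG hmuH hDH h22 => _ _ _ _.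
move: (omega 2%N 1%N) (omega 1%N 2%N) (omega 2%N 2%N) (G 1%N 2%N) (G 2%N 1%N)
  (G 2%N 2%N) DHb muHbb muH11 G12bb G21b G12ul G12ur.
rewrite /tpow => DH muH w22 G12 G21 G22 DHb muHbb muH11 G12bb G21b G12ul G12ur.
have lD1 : linear (fun h : H => Delta (g h)) by move=> k x y; rewrite linearP lDelta.
have lG21 : linear G21 by exact: linearP.
have lDH : linear DH by exact: linearP.
have lDg : linear (fun h : H => tmap g g (DH h)).
  by move=> k x y; rewrite linearP linearP.
have lG12 : linear G12 by exact: linearP.
have lmg : linear (fun y : tens H H => mu (tmap g g y)).
  by move=> k x y; rewrite linearP lmu.
have lgm : linear (fun y : tens H H => g (muH y)).
  by move=> k x y; rewrite !linearP.
have lg : linear g by exact: linearP.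
have mu0 : mu 0 = 0.
  by have := lmu 1 0 0; rewrite !scale1r addr0 => ->; exact: F2_addxx.
have lmm : linear (tmap mu mu) by exact: linearP.
rewrite !tmap_tn// G21b tn0r tn0l addr0 !linear0 add0r.
rewrite DHb !(tnDl, tnDr) !linearD/= !sigma22_tn !tmap_tn//.
rewrite !G12ul !G12ur !tn0l !tn0r !addr0 !add0r muHbb linear0 addr0 muH11.
rewrite G12bb g1 mu1 Dc => e.
apply: (tensor_classes_eq (y := G22 (cls b ⊗ cls b)) hg).
rewrite tmap_tn// ga ga' e.
set x := one ⊗ c; set y := c ⊗ one; set w := tmap g g _; set z := a ⊗ a'.
by rewrite (addrAC x z y) addrACA F2_addxx add0r.
Qed.

End TransferEvaluation.

(** * The bar construction *)

Section DirectSumEval.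
Variable M : nat -> lmodType 'F_2.

Lemma dincD n (x y : M n) : dinc (x + y) = dinc x + dinc y.
Proof.
have := @gen_respects _ (@dsum_rels M)
  [:: existT _ n (x + y); existT _ n x; existT _ n y].
rewrite !big_cons big_nil addr0 addrA => h; apply/F2_triple/h.
by exists n, x, y.
Qed.

Lemma dsum_additive_respects (U : lmodType 'F_2) (F : {n : nat & M n} -> U) :
  (forall n, {morph (fun x : M n => F (existT _ n x)) : x y / x + y}) ->
  respects (@dsum_rels M) F.
Proof.
move=> FD r [n [x [y ->]]]; rewrite !big_cons big_nil FD addr0.
by rewrite -addrA addrA F2_addxx.
Qed.

(** The projection onto the [n]-th summand is a left inverse; it has to compare indices and
    transport along the resulting equality, whence [ecast]. *)
Lemma dinc_inj n : injective (@dinc M n).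
Proof.
pose F (p : {n : nat & M n}) : M n :=
  if tag p =P n is ReflectT e then ecast m (M m) e (tagged p) else 0.
have FE (z : M n) : F (existT _ n z) = z.
  by rewrite /F/=; case: eqP => // e; rewrite eq_axiomK.
have rF : respects (@dsum_rels M) F.
  apply: dsum_additive_respects => m u v; rewrite /F/=; clear FE F.
  by case: eqP => [e|_]; [case: n / e|rewrite addr0].
by move=> x y /(congr1 (plift F)); rewrite !plift_gen// !FE.
Qed.

End DirectSumEval.

Section BarWords.
Variable V : lmodType 'F_2.
Local Notation B := (talg V).

Lemma bar_wordD (s t : seq V) (x y : V) :
  bar_word (s ++ (x + y) :: t) =
  bar_word (s ++ x :: t) + bar_word (s ++ y :: t).
Proof.
have := @gen_respects _ (@talg_rels V)
  [:: s ++ (x + y) :: t; s ++ x :: t; s ++ y :: t].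
rewrite !big_cons big_nil addr0 addrA => h; apply/F2_triple/h.
by exists s, t, x, y.
Qed.

Lemma talg_multilinear_respects (U : lmodType 'F_2) (F : seq V -> U) :
  (forall s t x y, F (s ++ (x + y) :: t) = F (s ++ x :: t) + F (s ++ y :: t)) ->
  respects (@talg_rels V) F.
Proof.
move=> FD r [s [t [x [y ->]]]]; rewrite !big_cons big_nil FD addr0.
by rewrite -addrA addrA F2_addxx.
Qed.

Lemma plift_word (U : lmodType 'F_2) (F : seq V -> U) w :
  (forall s t x y, F (s ++ (x + y) :: t) = F (s ++ x :: t) + F (s ++ y :: t)) ->
  plift F (bar_word w) = F w.
Proof. by move=> FD; apply: plift_gen; exact: talg_multilinear_respects. Qed.

Definition bar_cons (a : V) : B -> B := plift (fun w => bar_word (a :: w)).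
HB.instance Definition _ a :=
  GRing.Linear.copy (bar_cons a) (plift (fun w => bar_word (a :: w))).

Lemma bar_cons_word a w : bar_cons a (bar_word w) = bar_word (a :: w).
Proof.
by rewrite /bar_cons plift_word// => s t x y; exact: (bar_wordD (a :: s)).
Qed.

(** Projection onto the words of length one is multilinear: splitting a letter of a longer word
    gives [0 = 0 + 0]. *)
Lemma bar_word1_inj : injective (fun x : V => bar_word [:: x]).
Proof.
move=> x y; pose F (w : seq V) := if w is [:: z] then z else 0.
have rF : respects (@talg_rels V) F.
  apply: talg_multilinear_respects => -[|z s] [|u t] u' v //=;
    rewrite ?addr0//; by case: s => [|? ?] /=; rewrite addr0.
by move=> /(congr1 (plift F)); rewrite !plift_gen.
Qed.

Lemma bar_Delta_word (w : seq V) : bar_Delta (bar_word w) =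
  \sum_(i < (size w).+1) bar_word (take i w) ⊗ bar_word (drop i w).
Proof.
rewrite /bar_Delta plift_word// => s t x y.
rewrite !size_cat/= -big_split/=; apply: eq_bigr => i _.
rewrite !take_cat !drop_cat; case: ltnP => h; first by rewrite bar_wordD tnDr.
case: (i - size s)%N => [|k] /=; last by rewrite bar_wordD tnDl.
by rewrite (bar_wordD [::]) tnDr.
Qed.

Lemma bar_Delta_is_linear : linear (@bar_Delta V).
Proof. exact: linearP. Qed.

Section Differential.
Variable mul : V -> V -> V.
Hypotheses (mulDl : forall y, {morph mul^~ y : x x' / x + x'})
           (mulDr : forall x, {morph mul x : y y' / y + y'}).

(** A split letter takes part in at most two contractions, with its left and with its right
    neighbour. In the three cases of the induction it is the first letter, the second, or further to
    the right, where it does not meet the first contraction. *)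
Lemma bar_d_word (w : seq V) :
  bar_d mul (bar_word w) = \sum_(t <- bar_contract mul w) bar_word t.
Proof.
rewrite /bar_d plift_word// => s t x y.
have sum_cons a L : \sum_(u <- [seq a :: v | v <- L]) bar_word u =
    bar_cons a (\sum_(u <- L) bar_word u).
  by rewrite big_map linear_sum; apply: eq_bigr => u _ /=; rewrite bar_cons_word.
have contract2 a b v : \sum_(u <- bar_contract mul [:: a, b & v]) bar_word u =
    bar_word (mul a b :: v) + bar_cons a (\sum_(u <- bar_contract mul (b :: v))
      bar_word u).
  by rewrite [bar_contract _ _]/= big_cons sum_cons.
elim: s => [|a [|b s] IH].
- case: t => [|z t]; first by rewrite /= !big_nil addr0.
  rewrite !cat0s !contract2 mulDl (bar_wordD [::]) addrACA; congr (_ + _).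
  rewrite /bar_cons; set r := \sum_(u <- _) _.
  rewrite -pliftD; last 2 first.
  + by apply: talg_multilinear_respects => s ? ? ?; exact: (bar_wordD (_ :: s)).
  + by apply: talg_multilinear_respects => s ? ? ?; exact: (bar_wordD (_ :: s)).
  by apply: plift_eqfun => u; exact: (bar_wordD [::]).
- rewrite !cat_cons !cat0s !contract2 [in LHS]IH linearD/= mulDr.
  by rewrite (bar_wordD [::]) addrACA.
rewrite !cat_cons !contract2 -!cat_cons [in LHS]IH linearD/=.
by rewrite (bar_wordD (mul a b :: s)) addrACA.
Qed.

End Differential.
End BarWords.

Section BarMultiplication.
Variables (V : lmodType 'F_2) (phi : {linear tens (talg V) (talg V) -> V}).

Section Relabelling.
Variables (L : lmodType 'F_2).
Implicit Types (h : L -> V) (p : seq L * seq L).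

Definition map_pair h p : seq V * seq V := (map h p.1, map h p.2).

(** Words are cut by position, never according to their letters, so the list of cuts commutes with
    any relabelling. *)
Lemma psi_bar_map h p : psi_bar (map_pair h p) =
  [seq (map_pair h q.1, map_pair h q.2) | q <- psi_bar p].
Proof.
have splitsE : [seq ((take i (map_pair h p).1, take j (map_pair h p).2),
      (drop i (map_pair h p).1, drop j (map_pair h p).2))
      | i <- iota 0 (size (map_pair h p).1).+1,
        j <- iota 0 (size (map_pair h p).2).+1] =
    [seq (map_pair h q.1, map_pair h q.2) | q <-
      [seq ((take i p.1, take j p.2), (drop i p.1, drop j p.2))
        | i <- iota 0 (size p.1).+1, j <- iota 0 (size p.2).+1]].
  rewrite map_allpairs !size_map; apply: eq_allpairs => i j.
  by rewrite /map_pair -!map_take -!map_drop.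
rewrite /psi_bar splitsE.
rewrite filter_map; congr map; apply: eq_filter => q /=.
by rewrite /word2_size /map_pair/= !size_map.
Qed.

Lemma psi_bar_iter_map h k p : psi_bar_iter k (map_pair h p) =
  [seq map (map_pair h) s | s <- psi_bar_iter k p].
Proof.
elim: k => [//|k IH]; rewrite /psi_bar_iter !iterS -!/(psi_bar_iter _ _) IH.
rewrite map_flatten -!map_comp; congr flatten; apply: eq_map => s /=.
case: s => [//|q s] /=; rewrite psi_bar_map -!map_comp; exact: eq_map.
Qed.

(** Concatenating the entries of a term restores the two words; hence a label that occurs once in
    them occurs in exactly one entry of each term. *)
Lemma psi_bar_iter_flatten k p s : s \in psi_bar_iter k p ->
  flatten (map fst s) = p.1 /\ flatten (map snd s) = p.2.
Proof.
elim: k s => [|k IH] s.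
  by rewrite inE => /eqP -> /=; rewrite !cats0.
rewrite /psi_bar_iter iterS -/(psi_bar_iter _ _) => /flatten_mapP[[|q t] /IH//=].
move=> [<- <-] /mapP[r]; rewrite mem_filter => /andP[_] /allpairsP[[i j] /=].
by move=> [_ _ ->] -> /=; rewrite !catA !cat_take_drop.
Qed.

Variables (i0 : L) (h h1 h2 : L -> V).
Hypotheses (h_off : forall i, i != i0 -> h i = h1 i /\ h i = h2 i)
           (h_at : h i0 = h1 i0 + h2 i0).

Lemma relabel_off (w : seq L) : count_mem i0 w = 0%N ->
  map h w = map h1 w /\ map h w = map h2 w.
Proof.
move=> /eqP; rewrite -leqn0 leqNgt -has_count has_pred1 => w0.
by split; apply/eq_in_map => i iw; have [] := h_off (i := i) _ => //;
  apply: contraNneq w0 => <-.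
Qed.

Lemma relabel_word (w : seq L) : count_mem i0 w = 1%N ->
  bar_word (map h w) = bar_word (map h1 w) + bar_word (map h2 w).
Proof.
elim: w => [//|i w IH] /=; have [->|ii0] := eqVneq i i0.
  rewrite add1n => -[] /relabel_off[e1 e2].
  by rewrite h_at (bar_wordD [::]) /= {1}e1 e2.
rewrite add0n => /IH e; have [e1 e2] := h_off ii0.
by rewrite -!bar_cons_word e linearD/= {1}e1 e2.
Qed.

Definition phi_pair (q : seq V * seq V) : V := phi (bar_word q.1 ⊗ bar_word q.2).

(** The entry that contains [i0] splits because [phi] is linear on the tensor product; all other
    entries agree under [h], [h1] and [h2]. *)
Lemma relabel_phi_pairs (s : seq (seq L * seq L)) :
  (count_mem i0 (flatten (map fst s)) + count_mem i0 (flatten (map snd s)))%N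
    = 1%N ->
  bar_word (map phi_pair (map (map_pair h) s)) =
  bar_word (map phi_pair (map (map_pair h1) s)) +
  bar_word (map phi_pair (map (map_pair h2) s)).
Proof.
have off (t : seq (seq L * seq L)) :
    (count_mem i0 (flatten (map fst t)) + count_mem i0 (flatten (map snd t)))%N
      = 0%N ->
    map (map_pair h) t = map (map_pair h1) t /\
    map (map_pair h) t = map (map_pair h2) t.
  elim: t => [//|q t IH] /=; rewrite !count_cat => /eqP.
  rewrite !addn_eq0 => /andP[] /andP[/eqP q1 /eqP t1] /andP[/eqP q2 /eqP t2].
  have [|e1 e2] := IH; first by rewrite t1 t2.
  have [e3 e4] := relabel_off q1; have [e5 e6] := relabel_off q2.
  by rewrite /map_pair -e1 -e2 -e3 -e4 -e5 -e6.
elim: s => [//|q s IH] /=; rewrite !count_cat addnACA.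
case E : (count_mem i0 q.1 + count_mem i0 q.2)%N => [|[|n]]//.
  rewrite add0n => /IH e.
  have [e1 e2] : map_pair h q = map_pair h1 q /\ map_pair h q = map_pair h2 q.
    move/eqP: E; rewrite addn_eq0 => /andP[/eqP q1 /eqP q2].
    have [e3 e4] := relabel_off q1; have [e5 e6] := relabel_off q2.
    by rewrite /map_pair -e3 -e4 -e5 -e6.
  by rewrite -!bar_cons_word e linearD/= {1}e1 e2.
rewrite add1n => -[] /off[e1 e2]; rewrite -e1 -e2.
suff -> : phi_pair (map_pair h q) =
    phi_pair (map_pair h1 q) + phi_pair (map_pair h2 q).
  by rewrite (bar_wordD [::]).
rewrite /phi_pair /map_pair/= -linearD; congr (phi _).
case E1 : (count_mem i0 q.1) E => [|[|n]] E //.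
  have [e3 e4] := relabel_off E1.
  by rewrite (relabel_word E) tnDr -{1}e3 -e4.
case: E => /relabel_off[e3 e4].
by rewrite (relabel_word E1) tnDl -{1}e3 -e4.
Qed.

Lemma relabel_mu_word p :
  (count_mem i0 p.1 + count_mem i0 p.2)%N = 1%N ->
  mu_word phi (map_pair h p) =
  mu_word phi (map_pair h1 p) + mu_word phi (map_pair h2 p).
Proof.
move=> c1; rewrite /mu_word /word2_size /= !size_map.
have : (0 < size p.1 + size p.2)%N.
  have := leq_add (count_size (pred1 i0) p.1) (count_size (pred1 i0) p.2).
  by rewrite c1.
case: (size p.1 + size p.2)%N => //= n _.
rewrite -big_split/=; apply: eq_bigr => k _.
rewrite !psi_bar_iter_map !big_map -big_split/= big_seq_cond [RHS]big_seq_cond.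
apply: eq_bigr => s; rewrite andbT => /psi_bar_iter_flatten[e1 e2].
by apply: relabel_phi_pairs; rewrite e1 e2.
Qed.

End Relabelling.

(** A pair of words is encoded as one word with a cut, so that a single statement covers a split
    letter in either factor. *)
Definition cut (m : nat) (w : seq V) := (take m w, drop m w).

Lemma cut_cat m u v : size u = m -> cut m (u ++ v) = (u, v).
Proof. by move=> um; rewrite /cut take_size_cat ?drop_size_cat. Qed.

(** Distinct formal labels on the letters keep track of the letter that is
    split as a sum. *)
Lemma mu_word_multilinear (s t : seq V) (x y : V) (m : nat) :
  mu_word phi (cut m (s ++ (x + y) :: t)) =
  mu_word phi (cut m (s ++ x :: t)) + mu_word phi (cut m (s ++ y :: t)).
Proof.
rewrite /cut; set n := (size s + (size t).+1)%N.
(* The labels must lie in an ['F_2]-module, since [psi_bar] is defined for words over one; monomials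
   provide as many distinct labels as needed. *)
pose ls : seq {poly 'F_2} := mkseq (fun i => 'X^i) n.
have lsU : uniq ls.
  rewrite map_inj_uniq ?iota_uniq// => i j /(congr1 (fun p => size (p : {poly _}))).
  by rewrite !size_polyXn => -[].
have sls : size ls = n by rewrite size_mkseq.
pose h (w : seq V) (l : {poly 'F_2}) := nth 0 w (index l ls).
have hE w : size w = n -> (take m w, drop m w) =
    map_pair (h w) (take m ls, drop m ls).
  move=> sw; have e : map (h w) ls = w.
    apply: (@eq_from_nth _ 0); rewrite size_map sls ?sw// => i ni.
    by rewrite (nth_map 0) ?sls// /h index_uniq ?sls.
  by rewrite /map_pair/= map_take map_drop e.
have ks : (size s < size ls)%N by rewrite sls /n addnS ltnS leq_addr.
have nth_s z : nth 0 (s ++ z :: t) (size s) = z.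
  by rewrite nth_cat ltnn subnn.
rewrite !hE ?size_cat//.
apply: (@relabel_mu_word _ (nth 0 ls (size s))).
- move=> l ll0; have [lls|lls] := boolP (l \in ls); last first.
    by rewrite /h (memNindex lls) !nth_default// size_cat/= sls.
  have : index l ls != size s.
    by apply: contraNneq ll0 => <-; rewrite nth_index.
  rewrite /h !nth_cat; case: ltngtP => //= sl _.
  by rewrite -(subnSK sl).
- by rewrite /h index_uniq// !nth_s.
by rewrite /= -count_cat cat_take_drop count_uniq_mem// mem_nth.
Qed.

Lemma bar_mu_is_linear : linear (bar_mu phi).
Proof. exact: linearP. Qed.

Lemma bar_mu_word (u v : seq V) :
  bar_mu phi (bar_word u ⊗ bar_word v) = mu_word phi (u, v).
Proof.
pose F u v := mu_word phi (u, v).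
have rF w : respects (@talg_rels V) (F^~ w).
  apply: talg_multilinear_respects => s t x y.
  have := mu_word_multilinear s (t ++ w) x y (size s + (size t).+1).
  by rewrite -!cat_cons !catA !cut_cat ?size_cat.
have rF' w : respects (@talg_rels V) (F w).
  apply: talg_multilinear_respects => s t x y.
  have := mu_word_multilinear (w ++ s) t x y (size w).
  by rewrite -!catA !cut_cat.
rewrite /bar_mu tlift_tn.
- exact: (plift2_gen rF rF').
- by move=> w x y; rewrite linearD.
- by move=> w x y; exact: (plift2Dr rF rF').
Qed.

(** The term [k = 0] gives the one-letter word on [φ([x] ⊗ [y])], the term [k = 1] the two shuffles,
    which cancel when [x = y]. *)
Lemma bar_mu_letters (x y : V) :
  (forall z, phi (bar_word [:: z] ⊗ bar_unit V) = z) ->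
  (forall z, phi (bar_unit V ⊗ bar_word [:: z]) = z) ->
  bar_mu phi (bar_word [:: x] ⊗ bar_word [:: y]) =
  bar_word [:: phi (bar_word [:: x] ⊗ bar_word [:: y])] +
  (bar_word [:: x; y] + bar_word [:: y; x]).
Proof.
move=> phil phir; rewrite bar_mu_word /mu_word /=.
rewrite big_ord_recl big_ord1 /psi_bar_iter/= !big_cons !big_nil/= !addr0.
by rewrite !phil !phir [bar_word [:: y; x] + _]addrC.
Qed.

End BarMultiplication.

(** * Simplicial identities for cup and cup-1 products *)

Section DoubleSums.
Variable U : lmodType 'F_2.

(** Off the diagonals [k = i] and [k = i + 1], the entries below are shifted by one row and those
    above by one column. The same bookkeeping serves the coboundary of [⌣_1] and the prism
    operator. *)
Lemma sum_off_diagonals (R : nat -> nat -> U) p :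
  \sum_(0 <= i < p.+2) \sum_(0 <= k < p.+3) R i k =
  \sum_(0 <= i < p.+1) (\sum_(0 <= k < i.+1) R i.+1 k +
                        \sum_(i.+1 <= k < p.+2) R i k.+1) +
  \sum_(0 <= i < p.+2) (R i i + R i i.+1).
Proof.
have row i : (i < p.+2)%N -> \sum_(0 <= k < p.+3) R i k =
    \sum_(0 <= k < i) R i k + \sum_(i.+1 <= k < p.+2) R i k.+1 +
    (R i i + R i i.+1).
  move=> ip; rewrite (@big_cat_nat _ _ _ i)//=; last by rewrite ltnW// ltnW.
  rewrite -addrA; congr (_ + _).
  rewrite big_ltn 1?ltnW// big_ltn// addrA addrC; congr (_ + _).
  by rewrite big_add1.
rewrite big_nat_cond; under eq_bigr => i /andP[/andP[_ ip] _] do rewrite row//.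
rewrite -big_nat_cond !big_split/=; congr (_ + _).
rewrite [X in X + _]big_ltn// big_geq// add0r big_add1/=; congr (_ + _).
by rewrite [LHS]big_nat_recr//= [X in _ + X]big_geq// addr0.
Qed.

Lemma sum_telescope (D : nat -> U) n :
  \sum_(0 <= i < n) (D i + D i.+1) = D 0%N + D n.
Proof.
elim: n => [|n IH]; first by rewrite big_geq// F2_addxx.
by rewrite big_nat_recr//= IH addrA -(addrA (D 0%N)) F2_addxx addr0.
Qed.

End DoubleSums.

Section Vertices.
Variables (R : realType) (X : topologicalType).

(** [v] is meant to map [0, ..., m] to [0, ..., n]; out of range, [inord]
    yields vertex [0]. *)
Definition vtx n m (s : sing R X n) (v : nat -> nat) : sing R X m :=
  face (fun i : 'I_m.+1 => inord (v i)) s.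

Lemma vertex_map_comp m n l (f : 'I_m.+1 -> 'I_n.+1) (g : 'I_n.+1 -> 'I_l.+1)
    (t : Simplex R m) : vertex_map g (vertex_map f t) = vertex_map (g \o f) t.
Proof.
apply/val_inj/rowP => j; rewrite !mxE.
under eq_bigr do rewrite mxE.
rewrite (exchange_big_dep predT)//= [RHS]big_mkcond/=.
apply: eq_bigr => i _; have [gj|gj] := eqVneq (g (f i)) j.
  rewrite (big_pred1 (f i))// => k /=; rewrite (eq_sym k).
  by have [<-|] := eqVneq (f i) k; rewrite ?gj ?eqxx ?andbF.
rewrite big1// => k /andP[/eqP gk /eqP fk].
by case/eqP: gj; rewrite fk.
Qed.

Lemma face_comp m n l (f : 'I_m.+1 -> 'I_n.+1) (g : 'I_n.+1 -> 'I_l.+1)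
    (s : sing R X l) : face f (face g s) = face (g \o f) s.
Proof. by apply/continuousEP => t /=; rewrite vertex_map_comp. Qed.

Lemma vtx_ext n m (s : sing R X n) (v w : nat -> nat) :
  (forall i, (i <= m)%N -> v i = w i) -> vtx m s v = vtx m s w.
Proof.
move=> vw; congr face; apply/funext => i; congr inord; apply: vw.
by rewrite -ltnS.
Qed.

Lemma vtx_id n (s : sing R X n) : vtx n s id = s.
Proof.
apply/continuousEP => t /=; congr (s _); apply/val_inj/rowP => j; rewrite mxE.
by rewrite (big_pred1 j)// => i /=; rewrite inord_val.
Qed.

Lemma vtx_comp n m l (s : sing R X n) (v w : nat -> nat) :
  (forall i, (i <= l)%N -> (w i <= m)%N) ->
  vtx l (vtx m s v) w = vtx l s (v \o w).
Proof.
move=> wm; rewrite /vtx face_comp; congr face; apply/funext => i /=.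
by rewrite inordK// ltnS wm// -ltnS.
Qed.

Lemma vtx_lift n (s : sing R X n.+1) (i : 'I_n.+2) :
  face (lift i : 'I_n.+1 -> _) s = vtx n s (bump i).
Proof.
by congr face; apply/funext => j; rewrite -[LHS]inord_val.
Qed.

Lemma coboundaryE n (c : cochain R X n) s :
  coboundary c s = \sum_(0 <= i < n.+2) c (vtx n s (bump i)).
Proof. by rewrite big_mkord; apply: eq_bigr => i _; rewrite vtx_lift. Qed.

Lemma coboundary_vtx n m (c : cochain R X n) (s : sing R X m) v :
  coboundary c (vtx n.+1 s v) = \sum_(0 <= i < n.+2) c (vtx n s (v \o bump i)).
Proof.
rewrite coboundaryE !big_nat; apply: eq_bigr => i /andP[_ ip].
rewrite vtx_comp// => j jn; rewrite /bump.
by case: (i <= j)%N; rewrite ?add1n ?add0n// leqW.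
Qed.

(** The dimension [n] of the simplex is left free: [p + q.+1] and [(p + q).+1] are not convertible,
    so a Leibniz rule between typed cochains would need a cast. *)
Definition cup_at p q (c : cochain R X p) (e : cochain R X q) n
  (s : sing R X n) : ('F_2)^o := c (vtx p s id) * e (vtx q s (addn p)).

(** Omitting the last vertex in [δc] and the first vertex in [δe] both produce
    [c(0, ..., p) * e(p + 1, ..., p + q + 1)]; these two terms cancel and the others are the faces
    of the product. *)
Lemma coboundary_cup p q (c : cochain R X p) (e : cochain R X q)
    (s : sing R X (p + q).+1) :
  coboundary (cup_cochain c e) s =
  cup_at (coboundary c) e s + cup_at c (coboundary e) s.
Proof.
pose F k : ('F_2)^o := c (vtx p s (bump k)) * e (vtx q s (bump k \o addn p)).
have -> : coboundary (cup_cochain c e) s = \sum_(0 <= k < (p + q).+2) F k.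
  rewrite coboundaryE !big_nat; apply: eq_bigr => k /andP[_ kpq].
  rewrite /cup_cochain -/(vtx p _ id) -/(vtx q _ (addn p)) /F.
  congr (c _ * e _); rewrite vtx_comp// => i ip.
    by rewrite (leq_trans ip)// leq_addr.
  by rewrite leq_add2l.
rewrite (@big_cat_nat _ _ _ p.+1)//=; last by rewrite ltnS leqW// leq_addr.
rewrite /cup_at !coboundary_vtx (@big_nat_recr _ _ _ p.+1)//= mulrDl.
rewrite (big_ltn (m := 0%N) (n := q.+2))// mulrDr.
have -> : vtx p s (id \o bump p.+1) = vtx p s id.
  by apply: vtx_ext => i ip; rewrite /bump /= ltnNge ip.
have -> : vtx q s (addn p \o bump 0) = vtx q s (addn p.+1).
  by apply: vtx_ext => i _; rewrite /bump /= add1n addnS.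
rewrite -addrA [X in _ = _ + X]addrA F2_addxx add0r; congr (_ + _).
  rewrite mulr_suml !big_nat; apply: eq_bigr => k /andP[_ kp].
  congr (_ * e _); apply: vtx_ext => i _ /=.
  by rewrite /bump -ltnS (leq_trans kp)// ltnS leq_addr.
have -> : \sum_(p.+1 <= k < (p + q).+2) F k = \sum_(0 <= k < q.+1) F (k + p).+1.
  by rewrite big_add1/= -{1}(add0n p) big_addn -addnS addKn.
rewrite mulr_sumr big_add1/=.
rewrite !big_nat; apply: eq_bigr => k /andP[_ kp].
congr (c _ * e _); apply: vtx_ext => i ip /=.
  by rewrite /bump ltnNge (leq_trans ip)// leq_addl.
by rewrite /bump [(k + p)%N]addnC -addnS leq_add2l addnCA.
Qed.

Definition cup1_front q i k : nat := if (k <= i)%N then k else (k + q)%N.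

Definition cup1_at p q (c : cochain R X p.+1) (e : cochain R X q.+1) n
    (s : sing R X n) : ('F_2)^o :=
  \sum_(0 <= i < p.+1) c (vtx p.+1 s (cup1_front q i)) * e (vtx q.+1 s (addn i)).

Lemma cup1_cochainE p q (c : cochain R X p.+1) (e : cochain R X q.+1) s :
  cup1_cochain c e s = cup1_at c e s.
Proof. by rewrite /cup1_at big_mkord. Qed.

Lemma cup1_at_vtx p q (c : cochain R X p.+1) (e : cochain R X q.+1) n
    (s : sing R X n) v : cup1_at c e (vtx (p + q).+1 s v) =
  \sum_(0 <= i < p.+1) c (vtx p.+1 s (v \o cup1_front q i)) *
                       e (vtx q.+1 s (v \o addn i)).
Proof.
rewrite /cup1_at !big_nat; apply: eq_bigr => i /andP[_ ip].
congr (c _ * e _); rewrite vtx_comp// => k kp.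
  by rewrite /cup1_front; case: ifP; lia.
lia.
Qed.

(** Steenrod's coboundary formula. [L i k] is the [k]-th face of the [i]-th term; [D] and [S] are
    the terms of [δc ⌣_1 e] and [c ⌣_1 δe]. Faces with [k <= i] or [k > i + q + 1] are the
    off-diagonal entries of [D], the remaining ones the interior faces in [S]. The diagonals of [D]
    cancel against the outermost faces in [S], except for two corners, which are [e ⌣ c] and
    [c ⌣ e]. *)
Lemma coboundary_cup1 p q (c : cochain R X p.+1) (e : cochain R X q.+1)
    (s : sing R X (p + q).+2) :
  coboundary (cup1_cochain c e) s =
  cup1_at (coboundary c) e s + cup1_at c (coboundary e) s +
  (cup_at c e s + cup_at e c s).
Proof.
pose L i k : ('F_2)^o := c (vtx p.+1 s (bump k \o cup1_front q i)) *
  e (vtx q.+1 s (bump k \o addn i)).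
pose D i k : ('F_2)^o := c (vtx p.+1 s (cup1_front q i \o bump k)) *
  e (vtx q.+1 s (addn i)).
pose S i r : ('F_2)^o := c (vtx p.+1 s (cup1_front q.+1 i)) *
  e (vtx q.+1 s (addn i \o bump r)).
have -> : coboundary (cup1_cochain c e) s =
    \sum_(0 <= i < p.+1) \sum_(0 <= k < (p + q).+3) L i k.
  rewrite coboundaryE exchange_big_nat/=; apply: eq_bigr => k _.
  by rewrite cup1_cochainE cup1_at_vtx.
have -> : cup1_at (coboundary c) e s =
    \sum_(0 <= i < p.+2) \sum_(0 <= k < p.+3) D i k.
  by apply: eq_bigr => i _; rewrite coboundary_vtx mulr_suml.
have -> : cup1_at c (coboundary e) s =
    \sum_(0 <= i < p.+1) \sum_(0 <= r < q.+3) S i r.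
  by apply: eq_bigr => i _; rewrite coboundary_vtx mulr_sumr.
have L_low i k : (k < i.+1)%N -> L i k = D i.+1 k.
  by move=> ki; congr (c _ * e _); apply: vtx_ext => j _ /=;
    rewrite /cup1_front /bump; do ?case: ifP; lia.
have L_mid i r : (0 < r < q.+2)%N -> L i (r + i)%N = S i r.
  by move=> rq; congr (c _ * e _); apply: vtx_ext => j jp /=;
    rewrite /cup1_front /bump; do ?case: ifP; lia.
have L_high i k : (i < k)%N -> L i (k + q.+1)%N = D i k.+1.
  by move=> ik; congr (c _ * e _); apply: vtx_ext => j jp /=;
    rewrite /cup1_front /bump; do ?case: ifP; lia.
have D_diag i : D i.+1 i.+1 = S i 0%N.
  by congr (c _ * e _); apply: vtx_ext => j jp /=;
    rewrite /cup1_front /bump; do ?case: ifP; lia.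
have D_diag' i : D i i.+1 = S i q.+2.
  by congr (c _ * e _); apply: vtx_ext => j jp /=;
    rewrite /cup1_front /bump; do ?case: ifP; lia.
have D_first : D 0%N 0%N = cup_at e c s.
  rewrite /cup_at [RHS]mulrC; congr (c _ * e _); apply: vtx_ext => j _ //.
  by rewrite /= /cup1_front /bump leq0n add1n /= addSn addnC.
have D_last : D p.+1 p.+2 = cup_at c e s.
  by congr (c _ * e _); apply: vtx_ext => j jp /=;
    rewrite ?/id /cup1_front /bump; do ?case: ifP; lia.
have Lrow i : (i < p.+1)%N -> \sum_(0 <= k < (p + q).+3) L i k =
    (\sum_(0 <= k < i.+1) D i.+1 k + \sum_(i.+1 <= k < p.+2) D i k.+1) +
    \sum_(1 <= r < q.+2) S i r.
  move=> ip; rewrite (@big_cat_nat _ _ _ i.+1)//=; last by lia.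
  rewrite (@big_cat_nat _ _ _ (i + q.+2) i.+1)//=; [|lia|lia].
  rewrite addrA addrAC; congr (_ + _ + _).
  - by rewrite !big_nat; apply: eq_bigr => k /andP[_]; exact: L_low.
  - have -> : (i + q.+2 = i.+1 + q.+1)%N by lia.
    have -> : ((p + q).+3 = p.+2 + q.+1)%N by lia.
    rewrite big_addn addnK !big_nat; apply: eq_bigr => k /andP[ik _].
    exact: L_high.
  have -> : (i + q.+2 = q.+2 + i)%N by lia.
  rewrite -[i.+1]/(1 + i)%N big_addn addnK !big_nat; apply: eq_bigr => k.
  exact: L_mid.
have Srow i : \sum_(0 <= r < q.+3) S i r =
    \sum_(1 <= r < q.+2) S i r + (S i 0%N + S i q.+2).
  by rewrite big_ltn// big_nat_recr//= addrCA addrA.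
have sumL : \sum_(0 <= i < p.+1) \sum_(0 <= k < (p + q).+3) L i k =
    \sum_(0 <= i < p.+1) (\sum_(0 <= k < i.+1) D i.+1 k +
                          \sum_(i.+1 <= k < p.+2) D i k.+1) +
    \sum_(0 <= i < p.+1) \sum_(1 <= r < q.+2) S i r.
  rewrite -big_split/= !big_nat; apply: eq_bigr => i /andP[_ ip].
  exact: Lrow.
have sumD : \sum_(0 <= i < p.+2) (D i i + D i i.+1) =
    (cup_at e c s + \sum_(0 <= i < p.+1) S i 0%N) +
    (\sum_(0 <= i < p.+1) S i q.+2 + cup_at c e s).
  rewrite big_split/=; congr (_ + _).
    by rewrite big_ltn// big_add1/= D_first; under eq_bigr do rewrite D_diag.
  by rewrite big_nat_recr//= D_last; under eq_bigr do rewrite D_diag'.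
rewrite sumL sum_off_diagonals sumD; under [X in _ = _ + X + _]eq_bigr do
  rewrite Srow.
rewrite [X in _ = _ + X + _]big_split [X in _ = _ + (_ + X) + _]big_split/=.
move: (\sum_(_ <= _ < _) (_ + _)) (\sum_(_ <= _ < _) \sum_(_ <= _ < _) _)
  (\sum_(_ <= _ < _) S _ 0%N) (\sum_(_ <= _ < _) S _ q.+2)
  (cup_at c e s) (cup_at e c s) => x1 x2 x3 x4 x5 x6.
case: (F2_cases x1) => ->; case: (F2_cases x2) => ->;
case: (F2_cases x3) => ->; case: (F2_cases x4) => ->;
case: (F2_cases x5) => ->; case: (F2_cases x6) => ->;
  exact/val_inj.
Qed.

End Vertices.

(** * Functoriality of cohomology *)

Section Cohomology.
Variable R : realType.
Implicit Types X Y Z : topologicalType.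

Lemma cochainD X n (c e : cochain R X n) s : (c + e) s = c s + e s.
Proof. by []. Qed.

Lemma coboundaryK X n (c : cochain R X n) : coboundary (coboundary c) = 0.
Proof.
apply/funext => s; rewrite coboundaryE.
pose T i k : ('F_2)^o := c (vtx n s (bump i \o bump k)).
have TC i k : (i <= k)%N -> T i k = T k.+1 i.
  by move=> ik; congr c; apply: vtx_ext => j _ /=;
    rewrite /bump; do ?case: ifP; lia.
transitivity (\sum_(0 <= i < n.+3) \sum_(0 <= k < n.+2) T i k).
  by apply: eq_bigr => i _; rewrite coboundary_vtx.
transitivity (\sum_(0 <= i < n.+3) (\sum_(0 <= k < n.+2 | (k < i)%N) T i k +
    \sum_(0 <= k < n.+2 | (i <= k)%N) T i k)).
  apply: eq_bigr => i _; rewrite (bigID (fun k => (k < i)%N))/=; congr (_ + _).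
  by apply: eq_bigl => k; rewrite -leqNgt.
rewrite big_split/=.
rewrite [X in X + _]big_ltn// big_pred0// add0r big_add1/=.
rewrite [X in _ + X](exchange_big_dep_nat xpredT)//=.
rewrite [X in _ + X](_ : _ = \sum_(0 <= i < n.+2)
  \sum_(0 <= k < n.+2 | (k < i.+1)%N) T i.+1 k) ?F2_addxx//.
apply: eq_big_nat => i /andP[_ ip].
rewrite [RHS]big_mkcond [LHS]big_mkcond/= big_nat_recr//= leqNgt ip addr0.
by apply: eq_bigr => k _; rewrite ltnS; case: ifP => // /TC.
Qed.

Lemma hrep_coboundary X n (x : coh R X n) : coboundary (hrep x) = 0.
Proof. exact: hrep_cocycle. Qed.

Local Notation "c ≡ e" := (exists u, c = e + coboundary_pred R _ _ u)
  (at level 70).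

Lemma cls_cochain_eq X n (c e : cochain R X n) :
  coboundary c = 0 -> coboundary e = 0 -> c ≡ e -> cls c = cls e :> coh R X n.
Proof. by move=> dc de [u cE]; exact: (cls_eq dc de cE). Qed.

Section Cup.
Variables (X : topologicalType) (p q : nat).
Implicit Types (c : cochain R X p) (e : cochain R X q).

Lemma cup_cochainDl c c' e :
  cup_cochain (c + c') e = cup_cochain c e + cup_cochain c' e.
Proof. by apply/funext => s; exact: mulrDl. Qed.

Lemma cup_cochainDr c e e' :
  cup_cochain c (e + e') = cup_cochain c e + cup_cochain c e'.
Proof. by apply/funext => s; exact: mulrDr. Qed.

Lemma cup_cochain_cocycle c e : coboundary c = 0 -> coboundary e = 0 ->
  coboundary (cup_cochain c e) = 0.
Proof.
move=> dc de; apply/funext => s; rewrite coboundary_cup /cup_at dc de.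
by rewrite [X in X * _ + _](_ : _ = 0)// mul0r add0r; exact: mulr0.
Qed.
End Cup.

Lemma cup_coboundaryl X p q (u : cochain_pred R X p) (e : cochain R X q) :
  coboundary e = 0 ->
  exists w, cup_cochain (coboundary_pred R X p u) e = coboundary_pred R X _ w.
Proof.
move=> de; case: p u => [|p] u.
  exists 0; rewrite linear0; apply/funext => s; exact: mul0r.
exists (cup_cochain u e); apply/funext => s /=.
by rewrite coboundary_cup {2}/cup_at de [_ * _](_ : _ = 0) ?addr0//; exact: mulr0.
Qed.

Lemma cup_coboundaryr X p q (c : cochain R X p) (u : cochain_pred R X q) :
  coboundary c = 0 ->
  exists w, cup_cochain c (coboundary_pred R X q u) = coboundary_pred R X _ w.
Proof.
move=> dc; case: q u => [|q] u.
  exists 0; rewrite linear0; apply/funext => s; exact: mulr0.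
(* [coboundary_pred] reduces only in a degree that is visibly a successor, so [p + q.+1] is replaced
   by a variable equal to [(p + q).+1]. *)
suff h n : n = (p + q).+1 ->
    exists w, (fun s => cup_at c (coboundary u) s) = coboundary_pred R X n w.
  exact: h (addnS p q).
move=> ->; exists (cup_cochain c u); apply/funext => s /=.
by rewrite coboundary_cup {2}/cup_at dc [0 _ * _](_ : _ = 0) ?add0r//; exact: mul0r.
Qed.

Lemma cup_cls X p q (c : cochain R X p) (e : cochain R X q) :
  coboundary c = 0 -> coboundary e = 0 ->
  cup (cls c) (cls e) = cls (cup_cochain c e).
Proof.
move=> dc de; rewrite /cup.
have [u hc] := hrep_cls (coboundary_pred R X p) dc.
have [v he] := hrep_cls (coboundary_pred R X q) de.
have dhc := hrep_coboundary (cls c : coh R X p).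
apply: cls_cochain_eq; try by apply: cup_cochain_cocycle => //; exact: hrep_coboundary.
have [w wE] := cup_coboundaryr v dhc; have [w' w'E] := cup_coboundaryl u de.
exists (w + w'); rewrite [in LHS]he cup_cochainDr wE hc cup_cochainDl w'E.
by rewrite linearD -addrA [in RHS](addrC (coboundary_pred _ _ _ _)).
Qed.

Lemma cupDl X p q (x x' : coh R X p) (y : coh R X q) :
  cup (x + x') y = cup x y + cup x' y.
Proof.
rewrite -(cls_hrep x) -(cls_hrep x') -(cls_hrep y).
have dx := hrep_coboundary x; have dx' := hrep_coboundary x'.
have dy := hrep_coboundary y.
rewrite -clsD// !cup_cls//; last by rewrite linearD/= dx dx' addr0.
by rewrite cup_cochainDl clsD//; exact: cup_cochain_cocycle.
Qed.

Lemma cupDr X p q (x : coh R X p) (y y' : coh R X q) :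
  cup x (y + y') = cup x y + cup x y'.
Proof.
rewrite -(cls_hrep x) -(cls_hrep y) -(cls_hrep y').
have dx := hrep_coboundary x; have dy := hrep_coboundary y.
have dy' := hrep_coboundary y'.
rewrite -clsD// !cup_cls//; last by rewrite linearD/= dy dy' addr0.
by rewrite cup_cochainDr clsD//; exact: cup_cochain_cocycle.
Qed.

Section Pullback.
Variables (X Y : topologicalType) (f : continuousType X Y).

Lemma pullback_face m n (phi : 'I_m.+1 -> 'I_n.+1) (s : sing R X n) :
  (f \o face phi s : continuousType _ _) =
  face phi (f \o s : continuousType _ _).
Proof. exact/continuousEP. Qed.

Lemma coboundary_pullback n (c : cochain R Y n) :
  coboundary (pullback_cochain f c) = pullback_cochain f (coboundary c).
Proof.
apply/funext => s; apply: eq_bigr => i _.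
by rewrite /pullback_cochain pullback_face.
Qed.

Lemma pullback_cocycle n (c : cochain R Y n) : coboundary c = 0 ->
  coboundary (pullback_cochain f c) = 0.
Proof. by move=> dc; rewrite coboundary_pullback dc. Qed.

Lemma pullback_coboundary_pred n (u : cochain_pred R Y n) :
  exists w, pullback_cochain f (coboundary_pred R Y n u) =
            coboundary_pred R X n w.
Proof.
case: n u => [|n] u; first by exists 0; rewrite linear0.
by exists (pullback_cochain f u); rewrite /= coboundary_pullback.
Qed.

Lemma coh_map_cls n (c : cochain R Y n) : coboundary c = 0 ->
  coh_map f (cls c) = cls (pullback_cochain f c).
Proof.
move=> dc; have [u hc] := hrep_cls (coboundary_pred R Y n) dc.
have [w wE] := pullback_coboundary_pred u.
apply: cls_cochain_eq; try exact: pullback_cocycle.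
  exact/pullback_cocycle/hrep_coboundary.
by exists w; rewrite hc -wE.
Qed.

Lemma coh_mapD n (x y : coh R Y n) : coh_map f (x + y) = coh_map f x + coh_map f y.
Proof.
rewrite -(cls_hrep x) -(cls_hrep y).
have dx := hrep_coboundary x; have dy := hrep_coboundary y.
rewrite -clsD// !coh_map_cls//; last by rewrite linearD/= dx dy addr0.
by rewrite -clsD//; exact: pullback_cocycle.
Qed.

Lemma coh_map0 n : coh_map f (0 : coh R Y n) = 0.
Proof. by rewrite -(F2_addxx (0 : coh R Y n)) coh_mapD F2_addxx. Qed.

Lemma coh_map_cup p q (x : coh R Y p) (y : coh R Y q) :
  coh_map f (cup x y) = cup (coh_map f x) (coh_map f y).
Proof.
rewrite -(cls_hrep x) -(cls_hrep y).
have dx := hrep_coboundary x; have dy := hrep_coboundary y.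
rewrite cup_cls// !coh_map_cls//; last exact: cup_cochain_cocycle.
rewrite cup_cls; try exact: pullback_cocycle.
congr cls; apply/funext => s.
by rewrite /pullback_cochain /cup_cochain !pullback_face.
Qed.

Lemma pullback_cup1 p q (c : cochain R Y p.+1) (e : cochain R Y q.+1) :
  pullback_cochain f (cup1_cochain c e) =
  cup1_cochain (pullback_cochain f c) (pullback_cochain f e).
Proof.
apply/funext => s; apply: eq_bigr => i _.
by rewrite /pullback_cochain !pullback_face.
Qed.

End Pullback.

Lemma coh_map_id X n (x : coh R X n) (f : continuousType X X) :
  (forall y, f y = y) -> coh_map f x = x.
Proof.
move=> fE; rewrite -{1}(cls_hrep x) coh_map_cls; last exact: hrep_coboundary.
rewrite -[RHS]cls_hrep; congr cls; apply/funext => s; congr (hrep x _).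
by apply/continuousEP => t /=; rewrite fE.
Qed.

Lemma coh_map_comp X Y Z n (f : continuousType X Y) (g : continuousType Y Z)
    (h : continuousType X Z) (x : coh R Z n) :
  (forall y, h y = g (f y)) -> coh_map h x = coh_map f (coh_map g x).
Proof.
move=> hE; rewrite -(cls_hrep x); have dx := hrep_coboundary x.
rewrite !coh_map_cls//; last exact: pullback_cocycle.
congr cls; apply/funext => s; congr (hrep x _).
by apply/continuousEP => t /=; rewrite hE.
Qed.

Section Square.
Variable X : topologicalType.
Local Notation cup1 p q c e := (@cup1_cochain R X p q c e).

Lemma cup1_cochainDl p q (c c' : cochain R X p.+1) (e : cochain R X q.+1) :
  cup1 p q (c + c') e = cup1 p q c e + cup1 p q c' e.
Proof.
apply/funext => s; rewrite cochainD -big_split; apply: eq_bigr => i _.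
exact: mulrDl.
Qed.

Lemma cup1_cochainDr p q (c : cochain R X p.+1) (e e' : cochain R X q.+1) :
  cup1 p q c (e + e') = cup1 p q c e + cup1 p q c e'.
Proof.
apply/funext => s; rewrite cochainD -big_split; apply: eq_bigr => i _.
exact: mulrDr.
Qed.

Lemma cup1_at0l p q (e : cochain R X q.+1) n (s : sing R X n) :
  cup1_at (0 : cochain R X p.+1) e s = 0.
Proof. by rewrite /cup1_at big1// => i _; exact: mul0r. Qed.

Lemma cup1_at0r p q (c : cochain R X p.+1) n (s : sing R X n) :
  cup1_at c (0 : cochain R X q.+1) s = 0.
Proof. by rewrite /cup1_at big1// => i _; exact: mulr0. Qed.

Lemma cup1_cocycle (c : cochain R X 3) : coboundary c = 0 ->
  coboundary (cup1 2 2 c c) = 0.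
Proof.
move=> dc; apply/funext => s; rewrite coboundary_cup1.
by rewrite dc cup1_at0l cup1_at0r !F2_addxx.
Qed.

(** The three cross terms [c ⌣_1 δu], [δu ⌣_1 c] and [δu ⌣_1 δu] are, up to cup products, the
    coboundaries of [c ⌣_1 u], [u ⌣_1 c] and [u ⌣_1 δu]. The commutator of [c] and [u] appears twice
    and cancels; that of [u] and [δu] is the coboundary of [u ⌣ u]. *)
Lemma cup1_square_coboundary (c : cochain R X 3) (u : cochain R X 2) :
  coboundary c = 0 ->
  cup1 2 2 (c + coboundary u) (c + coboundary u) = cup1 2 2 c c +
    coboundary (cup1 2 1 c u + cup1 1 2 u c + cup1 1 2 u (coboundary u) +
                cup_cochain u u : cochain R X 4).
Proof.
move=> dc; rewrite cup1_cochainDl !cup1_cochainDr -addrA; congr (_ + _).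
rewrite !(linearD (@coboundary R X 4))/=; apply/funext => s.
have e1 := @coboundary_cup1 R X 2 1 c u s.
have e2 := @coboundary_cup1 R X 1 2 u c s.
have e3 := @coboundary_cup1 R X 1 2 u (coboundary u) s.
have e4 := @coboundary_cup R X 2 2 u u s.
rewrite !cochainD; move: e1 e2 e3 e4; rewrite dc coboundaryK => -> -> -> ->.
rewrite cup1_at0l !cup1_at0r !cup1_cochainE add0r !addr0.
move: (cup1_at c (coboundary u) s) (cup1_at (coboundary u) c s)
  (cup1_at (coboundary u) (coboundary u) s) (cup_at c u s) (cup_at u c s)
  (cup_at u (coboundary u) s) (cup_at (coboundary u) u s).
move=> x1 x2 x3 x4 x5 x6 x7; rewrite (addrC x5) (addrC x7).
move: (x4 + x5) (x6 + x7) => y z.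
case: (F2_cases x1) => ->; case: (F2_cases x2) => ->;
case: (F2_cases x3) => ->; case: (F2_cases y) => ->;
case: (F2_cases z) => ->; exact/val_inj.
Qed.

Lemma Sq2_cls (c : cochain R X 3) : coboundary c = 0 ->
  Sq2 (cls c) = cls (cup1 2 2 c c).
Proof.
move=> dc; rewrite /Sq2 /Sq_cup1.
have [u hc] := hrep_cls (coboundary_pred R X 3) dc.
apply: cls_cochain_eq; try exact: cup1_cocycle.
  exact/cup1_cocycle/hrep_coboundary.
by rewrite hc (cup1_square_coboundary u dc); eexists.
Qed.

End Square.

Lemma coh_map_Sq2 X Y (f : continuousType X Y) (x : coh R Y 3) :
  coh_map f (Sq2 x) = Sq2 (coh_map f x).
Proof.
rewrite -(cls_hrep x); have dx := hrep_coboundary x.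
rewrite Sq2_cls// !coh_map_cls//; last exact: cup1_cocycle.
rewrite Sq2_cls; last exact: pullback_cocycle.
by congr cls; exact: (@pullback_cup1 _ _ f 2 2).
Qed.

End Cohomology.

(** * Homotopy invariance *)

Lemma continuous_pair (T U V : topologicalType) (f : T -> U) (g : T -> V) :
  continuous f -> continuous g -> continuous (fun x => (f x, g x)).
Proof.
move=> cf cg x.
exact: (@cvg_pair _ _ _ (nbhs x) (nbhs (f x)) (nbhs (g x)) _ _ _ f g (cf x) (cg x)).
Qed.

Section HomotopyInvariance.
Variable R : realType.
Local Notation I := (unit_itv R).

(** The affine function with value [1] at the vertices selected by [chi] and [0] at the others. *)
Definition weight m (chi : nat -> bool) (t : Simplex R m) : R :=
  \sum_(j < m.+1 | chi j) val t 0 j.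

Lemma weight_itv m chi (t : Simplex R m) :
  weight chi t \in (`[0, 1]%classic : set R).
Proof.
have /set_mem [t0 t1] := valP t; apply/mem_set.
rewrite /weight /= in_itv/= sumr_ge0//= -t1.
rewrite [leRHS](bigID (fun j : 'I_m.+1 => chi j))/= lerDl sumr_ge0//.
Qed.

Definition weight_map m chi (t : Simplex R m) : I :=
  exist (fun u => u \in (`[0, 1]%classic : set R)) _ (weight_itv chi t).

Lemma weight_map_continuous m chi : continuous (@weight_map m chi).
Proof.
apply: (@continuous_comp_initial _ _ _ set_val (weight_map chi)).
have -> : set_val \o @weight_map m chi =
    (fun t : Simplex R m => \sum_(j < m.+1 | chi j) val t 0 j) by exact/funext.
apply: continuous_big => [x|j _]; first exact: add_continuous.
move=> t.
apply: (@continuous_comp _ _ _ (set_val : Simplex R m -> _) (fun u => u 0 j)).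
  exact: initial_continuous.
exact: coord_continuous.
Qed.

Lemma weight_vertex_map m n (f : 'I_m.+1 -> 'I_n.+1) (chi : nat -> bool)
    (t : Simplex R m) :
  weight chi (vertex_map f t) = \sum_(i < m.+1 | chi (f i)) val t 0 i.
Proof.
rewrite /weight (partition_big f (fun j : 'I_n.+1 => chi j))//=.
apply: eq_bigr => j cj; rewrite mxE; apply: eq_bigl => i.
by case: eqVneq => [->|]; rewrite ?cj ?andbF.
Qed.

Variables (X K : topologicalType) (H : continuousType (X * I)%type K).

Definition graph_map m (s : sing R X m) chi (t : Simplex R m) : X * I :=
  (s t, weight_map chi t).

Lemma graph_map_continuous m (s : sing R X m) chi :
  continuous (graph_map s chi).
Proof.
by apply: (@continuous_pair _ _ _ s (weight_map chi));
  [exact: cts_fun|exact: weight_map_continuous].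
Qed.

HB.instance Definition _ m (s : sing R X m) chi :=
  @isContinuous.Build _ _ (graph_map s chi) (@graph_map_continuous m s chi).

(** The simplex of [K] obtained from the simplex of [X * I] over [s] whose
    [j]-th vertex is at height [chi j]. *)
Definition prism_simplex m (s : sing R X m) (chi : nat -> bool) : sing R K m :=
  (H \o graph_map s chi : continuousType _ _).

Lemma prism_simplex_ext m (s : sing R X m) chi chi' :
  (forall j, (j <= m)%N -> chi j = chi' j) ->
  prism_simplex s chi = prism_simplex s chi'.
Proof.
move=> cc; apply/continuousEP => t /=; congr (H (_, _)); apply/val_inj => /=.
by apply: eq_bigl => j; rewrite cc// -ltnS.
Qed.

Lemma vtx_prism_simplex m n (s : sing R X m) chi w :
  (forall j, (j <= n)%N -> (w j <= m)%N) ->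
  vtx n (prism_simplex s chi) w = prism_simplex (vtx n s w) (chi \o w).
Proof.
move=> wm; apply/continuousEP => t /=; congr (H (_, _)); apply/val_inj => /=.
rewrite weight_vertex_map; apply: eq_bigl => j /=.
by rewrite inordK// ltnS wm// -ltnS.
Qed.

(** The usual triangulation of the prism: [unbump i] repeats vertex [i], and [ltn i] puts its second
    copy and all later vertices at the top. *)
Definition prism n (c : cochain R K n.+1) : cochain R X n := fun s =>
  \sum_(0 <= i < n.+1) c (prism_simplex (vtx n.+1 s (unbump i)) (ltn i)).

(** Since [δc = 0], the values of [c] on all faces of the prism simplices add up to [0]. The
    off-diagonal faces form the coboundary of [prism c]; the diagonal ones are the intermediate
    simplices [D i], and they telescope to the top and the bottom. *)
Lemma coboundary_prism n (c : cochain R K n.+1) (s : sing R X n.+1) :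
  coboundary c = 0 ->
  coboundary (prism c) s =
  c (prism_simplex s xpredT) + c (prism_simplex s xpred0).
Proof.
move=> dc.
pose W i k : ('F_2)^o := c (prism_simplex
  (vtx n.+1 s (unbump i \o bump k)) (ltn i \o bump k)).
pose D i : ('F_2)^o := c (prism_simplex s (leq i)).
have W0 : \sum_(0 <= i < n.+2) \sum_(0 <= k < n.+3) W i k = 0.
  rewrite big1// => i _.
  transitivity (coboundary c (prism_simplex (vtx n.+2 s (unbump i)) (ltn i)));
    last by rewrite dc.
  rewrite coboundaryE big_nat [RHS]big_nat; apply: eq_bigr => k /andP[_ kn].
  have bk j : (j <= n.+1)%N -> (bump k j <= n.+2)%N by rewrite /bump; lia.
  by rewrite vtx_prism_simplex// vtx_comp.
have E1 : coboundary (prism c) s = \sum_(0 <= i < n.+1)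
    (\sum_(0 <= k < i.+1) W i.+1 k + \sum_(i.+1 <= k < n.+2) W i k.+1).
  rewrite coboundaryE /prism exchange_big_nat/=.
  apply: eq_big_nat => i /andP[_ ip].
  rewrite (@big_cat_nat _ _ _ i.+1)//=; last by rewrite ltnS ltnW.
  have unb j : (j <= n.+1)%N -> (unbump i j <= n)%N by rewrite /unbump; lia.
  congr (_ + _); apply: eq_big_nat => k /andP[k1 k2]; congr c;
    rewrite vtx_comp//; congr (prism_simplex _ _).
  - by apply: vtx_ext => j _; rewrite /= /bump /unbump; lia.
  - by apply/funext => j; rewrite /= /bump; lia.
  - by apply: vtx_ext => j _; rewrite /= /bump /unbump; lia.
  - by apply/funext => j; rewrite /= /bump; lia.
have W_diag i : W i i = D i.
  congr c; rewrite -[in RHS](vtx_id s); congr (prism_simplex _ _).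
    by apply: vtx_ext => j _; rewrite /= /bump /unbump; lia.
  by apply/funext => j; rewrite /= /bump; lia.
have W_diag' i : W i i.+1 = D i.+1.
  congr c; rewrite -[in RHS](vtx_id s); congr (prism_simplex _ _).
    by apply: vtx_ext => j _; rewrite /= /bump /unbump; lia.
  by apply/funext => j; rewrite /= /bump; lia.
move: W0; rewrite sum_off_diagonals -E1.
under [X in _ + X]eq_bigr do rewrite W_diag W_diag'.
rewrite sum_telescope => /eqP; rewrite addr_eq0 F2_opp => /eqP ->.
congr (c _ + c _); apply: prism_simplex_ext => j jn //.
by apply/negbTE; rewrite -ltnNge.
Qed.

Lemma homotopy_coh_map n (f0 f1 : continuousType X K) (x : coh R K n.+1) :
  (forall y, H (y, I0 R) = f0 y) -> (forall y, H (y, I1 R) = f1 y) ->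
  coh_map f0 x = coh_map f1 x.
Proof.
move=> H0 H1; rewrite -(cls_hrep x); have dx := hrep_coboundary x.
rewrite !coh_map_cls//; apply: cls_cochain_eq; try exact: pullback_cocycle.
exists (prism (hrep x)); apply/funext => s; rewrite cochainD /=.
rewrite coboundary_prism//.
have -> : prism_simplex s xpredT = (f1 \o s : continuousType _ _).
  apply/continuousEP => t /=; rewrite -H1; congr (H (_, _)).
  by apply/val_inj => /=; have /set_mem[_ <-] := valP t.
have -> : prism_simplex s xpred0 = (f0 \o s : continuousType _ _).
  apply/continuousEP => t /=; rewrite -H0; congr (H (_, _)).
  by apply/val_inj => /=; rewrite /weight big_pred0.
by rewrite addrA F2_addxx add0r.
Qed.

End HomotopyInvariance.

(** A constant simplex of dimension [2n + 2] has [2n + 3] faces, all equal to the constant simplex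
    of dimension [2n + 1]. This number is odd, so a cocycle vanishes on the latter; the pullback is
    zero already as a cochain. *)
Lemma coh_map_cst (R : realType) (X K : topologicalType) (k : K) n
    (f : continuousType X K) (x : coh R K n.*2.+1) :
  (forall y, f y = k) -> coh_map f x = 0.
Proof.
move=> fk; rewrite -(cls_hrep x) coh_map_cls; last exact: hrep_coboundary.
rewrite -[RHS](cls0 (coboundary_pred R X n.*2.+1)); congr cls.
apply/funext => s; rewrite /pullback_cochain.
set t : sing R K n.*2.+1 := f \o s.
have := congr1 (fun c => c (vtx n.*2.+2 t (fun=> 0%N))) (hrep_coboundary x).
have vt i : vtx n.*2.+1 t ((fun=> 0%N) \o bump i) = t.
  by apply/continuousEP => y; rewrite /t /= !fk.
rewrite coboundary_vtx; under eq_bigr => i _ do rewrite vt.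
have y2 (y : ('F_2)^o) m : y *+ m.*2 = 0 by rewrite -muln2 mulrnA mulr2n F2_addxx.
by rewrite sumr_const_nat subn0 -[n.*2.+3]/(n.+1).*2.+1 mulrS y2 addr0.
Qed.

(** * Paths *)

Section Paths.
Variable R : realType.
Local Notation I := (unit_itv R).

Lemma continuous_unit_itv_val : continuous (val : I -> R).
Proof. exact: initial_continuous. Qed.

Lemma clamp_itv (r : R) :
  Num.min (Num.max r 0) 1 \in (`[0, 1]%classic : set R).
Proof.
apply/mem_set; rewrite /= in_itv/= ge_min lexx orbT andbT.
by rewrite le_min ler01 andbT le_max lexx orbT.
Qed.

(** A retraction of the line onto the interval; it makes the two formulas of a concatenation
    total. *)
Definition clamp (r : R) : I :=
  exist (fun t => t \in (`[0, 1]%classic : set R)) _ (clamp_itv r).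

Lemma clamp_id (r : R) : 0 <= r <= 1 -> val (clamp r) = r.
Proof. by move=> /andP[r0 r1] /=; rewrite max_l// min_l. Qed.

Lemma clamp_continuous : continuous clamp.
Proof.
apply: (@continuous_comp_initial _ _ _ set_val clamp) => r.
apply: (@continuous_min _ _ (fun r : R => Num.max r 0) (cst 1)); last exact: cvg_cst.
by apply: (@continuous_max _ _ id (cst 0)); [exact: cvg_id|exact: cvg_cst].
Qed.

Lemma unit_itv_compact : compact [set: I].
Proof.
have -> : [set: I] = clamp @` `[0, 1]%classic.
  apply/seteqP; split=> // t _; exists (val t).
    exact: set_mem (valP t).
  apply/val_inj/clamp_id; have := set_mem (valP t).
  by rewrite /= in_itv.
apply: continuous_compact; last exact: segment_compact.
exact/continuous_subspaceT/clamp_continuous.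
Qed.

Lemma unit_itv_hausdorff : hausdorff_space I.
Proof.
move=> p q pq; apply/val_inj/(@norm_hausdorff _ R) => A B pA qB.
have [t [tA tB]] := pq _ _ (continuous_unit_itv_val pA)
  (continuous_unit_itv_val qB).
by exists (val t).
Qed.

Lemma unit_itv_locally_compact : locally_compact [set: I].
Proof.
move=> x _; exists setT; first exact: filterT.
by split; [exact: unit_itv_compact|exact: closedT].
Qed.

Section PathSpace.
Variables (K : topologicalType) (k0 : K).

(** Evaluation is the uncurried inclusion of the path space into the compact-open function space;
    the exponential law applies because the interval is locally compact and Hausdorff. *)
Lemma path_eval_continuous :
  continuous (fun z : path_space R k0 * I => (val z.1 : I -> K) z.2).
Proof.
have -> : (fun z : path_space R k0 * I => (val z.1 : I -> K) z.2) =
    uncurry (fun c : path_space R k0 => (val c : I -> K)).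
  by apply/funext => -[].
apply: (@continuous_uncurry (path_space R k0) I K
  (fun c => (val c : I -> K))).
- exact: unit_itv_locally_compact.
- exact: unit_itv_hausdorff.
- exact: initial_continuous.
- by move=> c; have /set_mem[] := valP c.
Qed.

End PathSpace.

Section Concatenation.
Variables (T K : topologicalType) (h0 h1 : T * I -> K).
Hypotheses (h0c : continuous h0) (h1c : continuous h1)
           (h01 : forall x, h0 (x, I1 R) = h1 (x, I0 R)).

Definition concat (z : T * I) : K :=
  if val z.2 <= 2^-1 then h0 (z.1, clamp (2 * val z.2))
  else h1 (z.1, clamp (2 * val z.2 - 1)).

Lemma concat0 x : concat (x, I0 R) = h0 (x, I0 R).
Proof.
rewrite /concat /= invr_ge0 ler0n mulr0; congr (h0 (_, _)).
by apply/val_inj; rewrite clamp_id//= lexx ler01.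
Qed.

Lemma concat1 x : concat (x, I1 R) = h1 (x, I1 R).
Proof.
rewrite /concat /= ifF; last by apply/negbTE; rewrite -ltNge invf_lt1 ?ltr1n.
congr (h1 (_, _)); apply/val_inj; rewrite clamp_id//= mulr1; lra.
Qed.

Lemma concat_continuous : continuous concat.
Proof.
have hc (h : T * I -> K) (a : R) : continuous h ->
    continuous (fun z : T * I => h (z.1, clamp (2 * val z.2 - a))).
  move=> ch z; apply: (@continuous_comp _ _ _
    (fun z : T * I => (z.1, clamp (2 * val z.2 - a))) h); last exact: ch.
  apply: (@continuous_pair _ _ _ fst) => {}z; first exact: cvg_fst.
  apply: (@continuous_comp _ _ _ (fun z : T * I => 2 * val z.2 - a) clamp);
    last exact: clamp_continuous.
  apply: cvgB; last exact: cvg_cst.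
  apply: cvgM; first exact: cvg_cst.
  apply: (@continuous_comp _ _ _ snd (val : I -> R)); first exact: cvg_snd.
  exact: continuous_unit_itv_val.
have vc : continuous (fun z : T * I => val z.2).
  move=> z; apply: (@continuous_comp _ _ _ snd (val : I -> R)).
    exact: cvg_snd.
  exact: continuous_unit_itv_val.
pose A := [set z : T * I | val z.2 <= 2^-1].
pose B := [set z : T * I | 2^-1 <= val z.2].
apply/continuous_subspace_setT.
have -> : [set: T * I] = A `|` B.
  by apply/seteqP; split=> // z _; case: (leP (val z.2) 2^-1) => /= h;
    [left|right; rewrite /B /= ltW].
apply: withinU_continuous.
- exact: (closed_comp (fun z _ => vc z) (@closed_le _ 2^-1)).
- exact: (closed_comp (fun z _ => vc z) (@closed_ge _ 2^-1)).
- apply: (@subspace_eq_continuous _ _ _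
    (fun z : T * I => h0 (z.1, clamp (2 * val z.2 - 0)))).
    move=> z /set_mem zA; rewrite -[RHS]/(concat z) /concat ifT ?subr0//.
  exact/continuous_subspaceT/hc.
- apply: (@subspace_eq_continuous _ _ _
    (fun z : T * I => h1 (z.1, clamp (2 * val z.2 - 1)))).
    move=> z /set_mem zB; rewrite -[RHS]/(concat z) /concat; case: leP => // zA.
    have e : val z.2 = 2^-1 by apply/eqP; rewrite eq_le zA.
    rewrite e divff// subrr.
    have -> : clamp 1 = I1 R by apply/val_inj; rewrite clamp_id// ler01 lexx.
    have -> : clamp 0 = I0 R by apply/val_inj; rewrite clamp_id// ler01 lexx.
    by rewrite h01.
  exact/continuous_subspaceT/hc.
Qed.

End Concatenation.
End Paths.

(** * Spheres and the total space *)

Section Spheres.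
Variable R : realType.
Local Notation I := (unit_itv R).

Lemma sphere_coord_continuous n (i : 'I_n.+1) :
  continuous (fun x : sphere R n => val x 0 i).
Proof.
move=> x; apply: (@continuous_comp _ _ _
  (set_val : sphere R n -> _) (fun u : 'rV[R]_n.+1 => u 0 i)).
  exact: initial_continuous.
exact: coord_continuous.
Qed.

(** The coordinate of a point of [S^0] is [1] or [-1], never [0], so its sign is locally
    constant. *)
Lemma sphere0_continuous (K : topologicalType) (k0 k1 : K) :
  continuous (fun x : sphere R 0 => if 0 < val x 0 0 then k0 else k1).
Proof.
move=> x; have cx := @sphere_coord_continuous 0 0 x.
have x1 : val x 0 0 ^+ 2 = 1 by have /set_mem := valP x; rewrite /sphere_set /= big_ord1.
apply: (@cvg_near_cst _ _ _ _ _ (nbhs_filter x)); have [x0|x0|x0] := ltrgt0P (val x 0 0).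
- have : \forall y \near nbhs x, 0 < (val (y : sphere R 0) : 'rV[R]_1) 0 0.
    exact: (cvgr_gt (val x 0 0) cx).
  by apply: (@filterS _ _ (nbhs_filter x)) => y /= ->.
- have : \forall y \near nbhs x, (val (y : sphere R 0) : 'rV[R]_1) 0 0 < 0.
    exact: (cvgr_lt (val x 0 0) cx).
  by apply: (@filterS _ _ (nbhs_filter x)) => y /= y0; rewrite ltNge ltW.
- by move: x1; rewrite x0 expr0n => /eqP; rewrite eq_sym oner_eq0.
Qed.

Section Connectivity.
Variables (K : topologicalType) (n : nat).
Hypothesis hK : is_K_Z2 R K n.+1.

(** The map from [S^0] with value [k0] at the base point and [k1] at the other point is homotopic to
    a constant map, as [0 <> n.+1]; the track of the other point is the path. *)
Lemma K_Z2_path (k0 k1 : K) : exists c : I -> K,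
  [/\ continuous c, c (I0 R) = k0 & c (I1 R) = k1].
Proof.
have [h0 _] := hK k0.
have [|||h [hu hv _]] := h0 0%N _
  (mkcts (@cst_continuous (sphere R 0) K k0) : continuousType _ _)
  (mkcts (@sphere0_continuous K k0 k1) : continuousType _ _) => //.
  by rewrite /= /mkcts /= !mxE !eqxx ltr01.
have xP : (- delta_mx 0 0 : 'rV[R]_1) \in @sphere_set R 0.
  by apply/mem_set; rewrite /sphere_set /= big_ord1 !mxE !eqxx sqrrN expr1n.
pose x : sphere R 0 := exist (fun t => t \in _) _ xP.
exists (fun t => h (x, t)); split.
- move=> t; apply: (@continuous_comp _ _ _ (fun t : I => (x, t)) h);
    last exact: cts_fun.
  by apply: (@continuous_pair _ _ _ (cst x) id);
    [exact: cst_continuous|move=> ?; exact: cvg_id].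
- by rewrite hu.
- rewrite hv -[LHS]/(if 0 < (- delta_mx 0 0 : 'rV[R]_1) 0 0 then k0 else k1).
  rewrite !mxE !eqxx ifF//.
  by apply/negbTE; rewrite -leNgt oppr_le0 ler01.
Qed.

(** Triviality of [π_m] contracts [u] only to its own value [k] at the base point, whereas lifting
    to [X] requires [k0]; the contraction is therefore preceded by a path from [k0] to [k]. *)
Lemma K_Z2_null_homotopy m (k0 : K) (u : continuousType (sphere R m) K) :
  m <> n.+1 -> exists h : sphere R m * I -> K,
  [/\ continuous h, forall x, h (x, I0 R) = k0 & forall x, h (x, I1 R) = u x].
Proof.
move=> mn; pose k := u (sphere_base R m).
have [c [cc c0 c1]] := K_Z2_path k0 k.
have [hm _] := hK k.
have [||h [hu hv _]] := hm m mn
  (mkcts (@cst_continuous (sphere R m) K k) : continuousType _ _) u => //.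
pose h0 (z : sphere R m * I) := c z.2.
have ch0 : continuous h0.
  by move=> z; apply: (@continuous_comp _ _ _ snd c);
    [exact: cvg_snd|exact: cc].
have h01 x : h0 (x, I1 R) = h (x, I0 R) by rewrite hu.
exists (concat h0 h); split=> [|x|x].
- by apply: concat_continuous => //; exact: cts_fun.
- by rewrite concat0.
- by rewrite concat1.
Qed.

End Connectivity.

Section TotalSpace.
Variables (K : topologicalType) (k0 : K) (f : continuousType (Yspace R) K).

(** Currying [h] assigns to each [x] a path from [k0] to [f (u x)], which is the second coordinate
    of a point of the pullback. *)
Lemma Xspace_lift (T : topologicalType) (u : continuousType T (Yspace R))
    (h : T * I -> K) : continuous h ->
  (forall x, h (x, I0 R) = k0) -> (forall x, h (x, I1 R) = f (u x)) ->
  exists s : continuousType T (Xspace k0 f), forall x, Xproj k0 f (s x) = u x.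
Proof.
move=> ch hI0 hI1; have [cc cch] := continuous_curry ch.
have cP x : (curry h x : {compact-open, I -> K}) \in @path_set R K k0.
  by apply/mem_set; split; [exact: cch|exact: hI0].
pose c x : path_space R k0 := exist (fun t => t \in _) _ (cP x).
have cc' : continuous c by exact: (@continuous_comp_initial _ _ _ set_val c).
have sP x : (u x, c x) \in pullback_set f (@path_end R K k0).
  by apply/mem_set; exact: esym (hI1 x).
pose s x : Xspace k0 f := exist (fun t => t \in _) _ (sP x).
have cs : continuous s.
  apply: (@continuous_comp_initial _ _ _ set_val s).
  by apply: (@continuous_pair _ _ _ u c) => //; exact: cts_fun.
by exists (mkcts cs : continuousType _ _).
Qed.

Lemma Xspace_coh_map0 n (x : coh R K n.*2.+1) :
  coh_map (Xproj k0 f) (coh_map f x) = 0.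
Proof.
pose q (z : Xspace k0 f) : path_space R k0 := (val z).2.
pose H (z : Xspace k0 f * I) : K := (val (q z.1) : I -> K) z.2.
have cH : continuous H.
  move=> z; apply: (@continuous_comp _ _ _
    (fun z : Xspace k0 f * I => (q z.1, z.2))
    (fun z : path_space R k0 * I => (val z.1 : I -> K) z.2));
    last exact: path_eval_continuous.
  apply: (@continuous_pair _ _ _ (fun z => q z.1) snd) => {}z;
    last exact: cvg_snd.
  apply: (@continuous_comp _ _ _ fst q); first exact: cvg_fst.
  apply: (@continuous_comp _ _ _ (set_val : Xspace k0 f -> _) snd).
    exact: initial_continuous.
  exact: cvg_snd.
pose k : continuousType (Xspace k0 f) K :=
  mkcts (@cst_continuous (Xspace k0 f) K k0).
rewrite -(@coh_map_comp _ _ _ _ _ _ _ (f \o Xproj k0 f : continuousType _ _))//.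
rewrite -(@homotopy_coh_map R _ _ (mkcts cH : continuousType _ _) n.*2 k).
- exact: (@coh_map_cst _ _ _ k0).
- by move=> z; rewrite /mkcts /H /=; have /set_mem[] := valP (q z).
- by move=> z; have /set_mem := valP z; rewrite /pullback_set /= => ->.
Qed.

Lemma Xspace_coh_map_neq0 m n (hK : is_K_Z2 R K n.+1)
    (i : continuousType (sphere R m) (Yspace R))
    (r : continuousType (Yspace R) (sphere R m)) (e : coh R (sphere R m) m) :
  m <> n.+1 -> (forall x, r (i x) = x) -> e <> 0 ->
  coh_map (Xproj k0 f) (coh_map r e) <> 0.
Proof.
move=> mn ri e0 pe0.
have [h [ch h0 h1]] :=
  K_Z2_null_homotopy hK k0 (f \o i : continuousType _ _) mn.
have [s sE] := Xspace_lift ch h0 h1.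
(* As [r] after the projection after [s] is [r ∘ i], the identity, the class [e] is recovered from
   its pullback to [X]. *)
apply: e0; rewrite -(@coh_map_id _ _ _ e (r \o i : continuousType _ _))//.
rewrite (@coh_map_comp _ _ _ _ _ s (r \o Xproj k0 f : continuousType _ _)).
  rewrite (@coh_map_comp _ _ _ _ _ (Xproj k0 f) r)// pe0; exact: coh_map0.
by move=> x /=; rewrite sE.
Qed.

End TotalSpace.

Definition S2_to_Y (x : sphere R 2) : Yspace R :=
  @wedge_lift _ _ (wedge2_pt _ _) true (x, sphere_base R 3).

Definition S3_to_Y (x : sphere R 3) : Yspace R :=
  @wedge_lift _ _ (wedge2_pt _ _) true (sphere_base R 2, x).

Lemma S2_to_Y_continuous : continuous S2_to_Y.
Proof.
move=> x; apply: (@continuous_comp _ _ _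
  (fun x : sphere R 2 => (x, sphere_base R 3))); last exact: wedge_lift_continuous.
by apply: (@continuous_pair _ _ _ id (cst _));
  [move=> ?; exact: cvg_id|exact: cst_continuous].
Qed.

Lemma S3_to_Y_continuous : continuous S3_to_Y.
Proof.
move=> x; apply: (@continuous_comp _ _ _
  (fun x : sphere R 3 => (sphere_base R 2, x))); last exact: wedge_lift_continuous.
by apply: (@continuous_pair _ _ _ (cst _) id);
  [exact: cst_continuous|move=> ?; exact: cvg_id].
Qed.

Lemma S2_to_YK x : Y_to_S2 R (S2_to_Y x) = x.
Proof.
rewrite /Y_to_S2 /= /wedge2_fst /S2_to_Y wedge_lift_funE//.
by move=> [] [].
Qed.

Lemma S3_to_YK x : Y_to_S3 R (S3_to_Y x) = x.
Proof.
rewrite /Y_to_S3 /= /wedge2_fst /S3_to_Y wedge_lift_funE//.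
by move=> [] [].
Qed.

End Spheres.

(** * Letters of the bar construction *)

Section CohomologyBarWords.
Variables (R : realType) (X : topologicalType).
Local Notation S := {n : nat & coh R X n.+1}.

Let mulF (p q : S) : sH R X :=
  @sclass R X (tag p + (tag q).+1) (cup (tagged p) (tagged q)).

Lemma sclassD n (x y : coh R X n.+1) : sclass (x + y) = sclass x + sclass y.
Proof. exact: dincD. Qed.

Lemma sH_mul_respectsl (q : S) :
  respects (@dsum_rels (fun n => coh R X n.+1)) (mulF^~ q).
Proof.
apply: dsum_additive_respects => n x y.
by rewrite /mulF /= cupDl sclassD.
Qed.

Lemma sH_mul_respectsr (p : S) :
  respects (@dsum_rels (fun n => coh R X n.+1)) (mulF p).
Proof.
apply: dsum_additive_respects => n x y.
by rewrite /mulF /= cupDr sclassD.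
Qed.

Lemma sH_mulDl (y : sH R X) : {morph (@sH_mul R X)^~ y : x x' / x + x'}.
Proof. by move=> x x'; rewrite /sH_mul linearD. Qed.

Lemma sH_mulDr (x : sH R X) : {morph sH_mul x : y y' / y + y'}.
Proof. by move=> y y'; exact: (plift2Dr sH_mul_respectsl sH_mul_respectsr). Qed.

Lemma sH_mul_sclass m n (x : coh R X m.+1) (y : coh R X n.+1) :
  sH_mul (sclass x) (sclass y) = @sclass R X (m + n.+1) (cup x y).
Proof.
exact: (plift2_gen sH_mul_respectsl sH_mul_respectsr
  (existT _ m x) (existT _ n y)).
Qed.

Lemma bar_letter_neq0 n (x : coh R X n.+1) :
  x <> 0 -> bar_word [:: sclass x] <> 0 :> BA R X.
Proof.
move=> x0 wx0; apply/x0/(@dinc_inj (fun n => coh R X n.+1))/bar_word1_inj.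
apply: (etrans wx0).
have -> : @dinc (fun n => coh R X n.+1) n 0 = 0.
  by rewrite -(F2_addxx (0 : coh R X n.+1)) dincD F2_addxx.
by have := bar_wordD [::] [::] (0 : sH R X) 0; rewrite /= addr0 F2_addxx.
Qed.

Lemma BA_d_letter (x : sH R X) : @BA_d R X (bar_word [:: x]) = 0.
Proof.
rewrite [LHS](bar_d_word sH_mulDl sH_mulDr) /=; exact: big_nil.
Qed.

Lemma BA_d_letters (x y : sH R X) :
  @BA_d R X (bar_word [:: x; y]) = bar_word [:: sH_mul x y].
Proof.
rewrite [LHS](bar_d_word sH_mulDl sH_mulDr) /=; exact: big_seq1.
Qed.

End CohomologyBarWords.

Lemma bar_Delta_letter (V : lmodType 'F_2) (x : V) :
  bar_Delta (bar_word [:: x]) =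
  bar_unit V ⊗ bar_word [:: x] + bar_word [:: x] ⊗ bar_unit V.
Proof. by rewrite bar_Delta_word big_ord_recl big_ord1. Qed.

Lemma bar_Delta_letters (V : lmodType 'F_2) (x y : V) :
  bar_Delta (bar_word [:: x; y]) =
  bar_unit V ⊗ bar_word [:: x; y] + bar_word [:: x] ⊗ bar_word [:: y] +
  bar_word [:: x; y] ⊗ bar_unit V.
Proof. by rewrite bar_Delta_word big_ord_recl big_ord_recl big_ord1 addrA. Qed.

Theorem mainTheorem1 (R : realType)
  (e2 : coh R (sphere R 2) 2) (he2 : e2 <> 0)
  (e3 : coh R (sphere R 3) 3) (he3 : e3 <> 0)
  (eb : coh R (SigmaCP2 R) 3) (heb : eb <> 0)
  (K : topologicalType) (k0 : K) (hK : is_K_Z2 R K 5)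
  (iota5 : coh R K 5) (hiota5 : iota5 <> 0)
  (f : continuousType (Yspace R) K)
  (hf : let a2bar := coh_map (Y_to_S2 R) e2 in
        let a3bar := coh_map (Y_to_S3 R) e3 in
        let bbar := coh_map (Y_to_SigmaCP2 R) eb in
        coh_map f iota5 = cup a2bar a3bar + Sq2 bbar) :
  let X := Xspace k0 f in
  let p := Xproj k0 f in
  let a2 := coh_map p (coh_map (Y_to_S2 R) e2) in
  let a3 := coh_map p (coh_map (Y_to_S3 R) e3) in
  let b := coh_map p (coh_map (Y_to_SigmaCP2 R) eb) in
  let one := bar_unit (sH R X) in
  let w_a2 := bar_word [:: sclass a2] in
  let w_a3 := bar_word [:: sclass a3] in
  let w_b := bar_word [:: sclass b] in
  let H := HBA R X in
  let alpha2 : H := cls w_a2 in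
  let alpha3 : H := cls w_a3 in
  let beta : H := cls w_b in
  forall (phi : {linear tens (BA R X) (BA R X) -> sH R X})
    (hphi : is_twisting_map b phi)
    (g : {linear H -> BA R X}) (hg : cocycle_selecting g)
    (hg_one : g (cls one) = one) (hg_alpha2 : g alpha2 = w_a2)
    (hg_alpha3 : g alpha3 = w_a3) (hg_beta : g beta = w_b)
    (omega : forall n m, {linear tpow H m -> tpow H n})
    (G : forall n m, {linear tpow H m -> tpow (BA R X) n})
    (hG : is_transfer (@grading_BA R X) (@bar_Delta (sH R X)) (bar_mu phi) one
            g omega G)
    (hG12 : G 1%N 2%N (beta ⊗ beta) = bar_word [:: sclass a2; sclass a3])
    (hG21 : G 2%N 1%N beta = 0),
  omega 2%N 2%N (beta ⊗ beta) = alpha2 ⊗ alpha3 /\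
  (exists x : tens H H, omega 2%N 2%N x <> 0).
Proof.
move=> X p a2 a3 b one w_a2 w_a3 w_b H alpha2 alpha3 beta phi hphi g hg
  hg_one hg_alpha2 hg_alpha3 hg_beta omega G hG hG12 hG21.
have a2_neq0 : a2 <> 0.
  (* The [4] is the [n] of a [K(Z_2, n + 1)]; the lift of [S^2] exists because [2 <> 5]. *)
  apply: (@Xspace_coh_map_neq0 R K k0 f 2 4 hK (mkcts (@S2_to_Y_continuous R)))
    => //.
  exact: S2_to_YK.
have a3_neq0 : a3 <> 0.
  apply: (@Xspace_coh_map_neq0 R K k0 f 3 4 hK (mkcts (@S3_to_Y_continuous R)))
    => //.
  exact: S3_to_YK.
have Sq2b : Sq2 b = cup a2 a3.
  have e : @coh_map R X (Yspace R) p 5 (coh_map f iota5) = 0.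
    (* The index [2] encodes the odd degree [5 = 2.*2.+1]. *)
    exact: (@Xspace_coh_map0 R K k0 f 2).
  have /eqP : cup a2 a3 + Sq2 b = 0.
    rewrite -[RHS]e hf coh_mapD coh_map_Sq2; congr (_ + _).
    exact/esym/(coh_map_cup p).
  by rewrite addr_eq0 F2_opp => /eqP ->.
have [_ phil phir phib hopf] := hphi.
have lmu : linear (bar_mu phi) by exact: bar_mu_is_linear.
have mu_bb : bar_mu phi (w_b ⊗ w_b) = BA_d R X (bar_word [:: sclass a2; sclass a3]).
  rewrite bar_mu_letters// F2_addxx addr0 phib Sq2b BA_d_letters.
  by rewrite sH_mul_sclass.
have omega_bb : omega 2%N 2%N (beta ⊗ beta) = alpha2 ⊗ alpha3.
  have db : BA_d R X w_b = 0 := BA_d_letter _.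
  exact: (transfer_omega22 (bar_Delta_is_linear (V := sH R X)) lmu
    (DG_Hopf_dd hopf) (DG_Hopf_d_one hopf) hG hg db
    (DG_Hopf_unitl hopf one) (bar_Delta_letter _) (bar_Delta_letters _ _)
    (esym mu_bb) hg_one hg_alpha2 hg_alpha3 hG12 hG21).
split=> //; exists (beta ⊗ beta); rewrite omega_bb.
apply: tn_neq0 => alpha0.
  by apply: (bar_letter_neq0 a2_neq0); rewrite -/w_a2 -hg_alpha2 alpha0 linear0.
by apply: (bar_letter_neq0 a3_neq0); rewrite -/w_a3 -hg_alpha3 alpha0 linear0.
Qed.
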